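(* If $U\subset\mathbb{C}^n$ is a domain of holomorphy, then $U$ satisfies the continuity principle.
   Context: A domain is a connected open set. For $U\subset\mathbb{C}^n$ open, a holomorphic function $f$ on $U$ extends holomorphically to a point $a\in\mathbb{C}^n\setminus U$ if there are a connected open neighbourhood $V$ of $a$ and a holomorphic function $g$ on $V$ such that $f\equiv g$ on some non-empty open subset of $U\cap V$ (agreement on all of $U\cap V$ is not required). A domain $U$ is a domain of holomorphy if there is a holomorphic function on $U$ that does not extend holomorphically to any point of $\mathbb{C}^n\setminus U$. Write $B(0,1)$ for the open unit disc in $\mathbb{C}$. A holomorphic disc is a continuous map $S\colon\overline{B(0,1)}\to\mathbb{C}^n$ whose restriction to $B(0,1)$ is holomorphic; the image $S(B(0,1))$ is also denoted $S$, and the boundary is $\partial S:=S(\partial B(0,1))$. For sets $S_j,S$ in $\mathbb{C}^n$, $S_j\to S$ means: for every $\epsilon>0$ there is $J$ such that for all $j\ge J$, $S_j$ is contained in the $\epsilon$-enlargement of $S$ and $S$ is contained in the $\epsilon$-enlargement of $S_j$ (enlargements with respect to the $L^\infty$ metric $\max_k|z_k-w_k|$). A domain $U\subset\mathbb{C}^n$ satisfies the continuity principle if for every sequence $\{S_j\}_{j\ge1}$ of holomorphic discs with $S_j\cup\partial S_j\subset U$ for all $j$, $\partial S_j\to B$ and $S_j\to T$, where $B\subset U$ and $T\subset\mathbb{C}^n$ are compact, one has $T\subset U$. *)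

(* Defs.v *)
From HB Require Import structures.
From mathcomp Require Export all_boot all_order all_algebra.
From mathcomp Require Export all_classical all_reals all_analysis.
From mathcomp Require Export complex.
Set Implicit Arguments.
Unset Strict Implicit.
Unset Printing Implicit Defensive.
Import Order.TTheory GRing.Theory Num.Theory.
Export numFieldNormedType.Exports.
Local Open Scope classical_set_scope.
Local Open Scope ring_scope.
Local Open Scope complex_scope.

(* The topology and the norm on the complex numbers are carried by the regular
   algebra R[i]^o, so that C is R[i]^o and C^n is 'rV[R[i]^o]_n.  The norms take
   their values in R[i]; an inequality between such values forces their
   difference to be real.  The ball of 'rV[R[i]^o]_n is the entrywise one, that
   is, the ball of the L^oo metric. *)

Section Domains.
Context {R : realType} {n : nat}.
Local Notation C := (R[i]^o).
Local Notation Cn := ('rV[C]_n).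

Definition is_domain (U : set Cn) : Prop := open U /\ connected U.

(* [differentiable] is Frechet differentiability over the field of scalars,
   here the complex numbers.  The values of f off U play no role, U being
   open. *)
Definition holomorphic_on (U : set Cn) (f : Cn -> C) : Prop :=
  forall z, U z -> differentiable f z.

(* f and g need to agree only on some nonempty open W, not on all of U `&` V. *)
Definition extends_holomorphically_to (U : set Cn) (f : Cn -> C) (a : Cn) :
    Prop :=
  exists (V : set Cn) (g : Cn -> C),
    [/\ open V, connected V, V a, holomorphic_on V g
      & exists W : set Cn,
          [/\ open W, W !=set0, W `<=` U `&` V & forall z, W z -> f z = g z]].

Definition domain_of_holomorphy (U : set Cn) : Prop :=
  is_domain U /\
  exists f : Cn -> C, holomorphic_on U f /\
    forall a, ~ U a -> ~ extends_holomorphically_to U f a.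

Definition unit_disc : set C := [set t | `|t| < 1].
Definition closed_unit_disc : set C := [set t | `|t| <= 1].
Definition unit_circle : set C := [set t | `|t| = 1].

(* Only the values of S on the closed unit disc matter. *)
Definition holomorphic_disc (S : C -> Cn) : Prop :=
  {within closed_unit_disc, continuous S} /\
  (forall t, unit_disc t -> differentiable S t).

Definition disc_image (S : C -> Cn) : set Cn := S @` unit_disc.
Definition disc_boundary (S : C -> Cn) : set Cn := S @` unit_circle.

Definition enlargement (A : set Cn) (e : R) : set Cn :=
  \bigcup_(w in A) ball w e%:C.

Definition sets_converge (A : nat -> set Cn) (B : set Cn) : Prop :=
  forall e : R, 0 < e -> exists J : nat, forall j : nat, (J <= j)%N ->
    A j `<=` enlargement B e /\ B `<=` enlargement (A j) e.

Definition continuity_principle (U : set Cn) : Prop :=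
  forall (S : nat -> C -> Cn) (B T : set Cn),
    (forall j, holomorphic_disc (S j)) ->
    (forall j, disc_image (S j) `|` disc_boundary (S j) `<=` U) ->
    compact B -> B `<=` U -> compact T ->
    sets_converge (fun j => disc_boundary (S j)) B ->
    sets_converge (fun j => disc_image (S j)) T ->
    T `<=` U.

End Domains.

(* Main.v *)
From HB Require Import structures.
From mathcomp Require Import ring lra.
Require Import Defs.
Set Implicit Arguments.
Unset Strict Implicit.
Unset Printing Implicit Defensive.
Import Order.TTheory GRing.Theory Num.Theory.
Local Open Scope classical_set_scope.
Local Open Scope ring_scope.
Local Open Scope complex_scope.

(** Let f be holomorphic on U with no extension to any point outside U, and let
   r > 0 be such that the 3r-enlargement of B lies in U.  For j large the
   boundary of S_j is within r of B; fix t0 in the open unit disc and let C be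
   a circle |z| = rho < 1 around t0, so close to the unit circle that S_j(C) is
   within 2r of B.  Then
     g(v) = (1 / 2 i pi) \oint_C f(v + S_j(z) - S_j(t0)) / (z - t0) dz
   is holomorphic on the ball of radius r around S_j(t0), and, by Cauchy's
   formula in the single variable z, g = f near S_j(t0).  As f does not extend,
   that ball lies in U; each point of T is in such a ball.

   Cauchy's formula is obtained from Goursat's lemma for parallelograms: applied
   to h o exp on a rectangle of height 2 pi, it shows that the mean of h on the
   circles |z| = r does not depend on r as long as h is holomorphic on the
   annulus they sweep. *)

(** The radius [r] depends on [U] and [B] only, not on [j]. This is why one ball suffices: given a
    point [w] of T, the index [j] and then [t0] can be chosen with S_j(t0) within [r] of [w]. The
    allowance 3r splits into 2r, the distance from S_j(C) to B, and r, the size of the translation v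
    - S_j(t0). The formula for g evaluates f on translates of the circle only, so it makes sense
    even when the translated disc leaves U; it is compared with f only where the whole translated
    disc stays in U.

    Two obstacles shape the rest. Differentiability is pointwise and nothing is assumed about the
    derivative, hence Goursat's bisection, and hence a form of Cauchy's formula that gets past a
    point where the difference quotient is only known to be continuous. Moreover g must be Frechet
    differentiable in v: differentiating under the mean takes a remainder bound uniform along the
    circle, and this comes from Cauchy's formula again, applied to f on complex lines. Integrals are
    limits of dyadic sums because bisection of an edge is then the recursion of the sum itself. *)

Section RealNorm.
Context {R : realType}.

(* The norms take their values in R[i]; nr is real-valued, so that lra applies. *)
Definition nr {V : normedZmodType R[i]} (v : V) : R := complex.Re `|v|.

Lemma nrE (V : normedZmodType R[i]) (v : V) : `|v| = (nr v)%:C.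
Proof. by rewrite RRe_real // normr_real. Qed.

Lemma nr_ge0 (V : normedZmodType R[i]) (v : V) : 0 <= nr v.
Proof. by rewrite -ler0c -nrE normr_ge0. Qed.

Lemma ler_nrD (V : normedZmodType R[i]) (v w : V) : nr (v + w) <= nr v + nr w.
Proof. by rewrite -lecR rmorphD /= -!nrE ler_normD. Qed.

Lemma nrN (V : normedZmodType R[i]) (v : V) : nr (- v) = nr v.
Proof. by rewrite /nr normrN. Qed.

Lemma nrBC (V : normedZmodType R[i]) (v w : V) : nr (v - w) = nr (w - v).
Proof. by rewrite /nr distrC. Qed.

Lemma ler_nrB (V : normedZmodType R[i]) (v w : V) : nr (v - w) <= nr v + nr w.
Proof. by rewrite -(nrN w) ler_nrD. Qed.

Lemma ler_nrBD (V : normedZmodType R[i]) (u v w : V) :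
  nr (u - w) <= nr (u - v) + nr (v - w).
Proof. by rewrite -[u - w](subrKA v) ler_nrD. Qed.

Lemma nr0 (V : normedZmodType R[i]) : nr (0 : V) = 0.
Proof. by rewrite /nr normr0. Qed.

Lemma nr_eq0 (V : normedZmodType R[i]) (v : V) : (nr v == 0) = (v == 0).
Proof.
by rewrite -(inj_eq (@complexI R)) rmorph0 -nrE normr_eq0.
Qed.

Lemma nr_gt0 (V : normedZmodType R[i]) (v : V) : (0 < nr v) = (v != 0).
Proof. by rewrite lt_neqAle nr_ge0 andbT eq_sym nr_eq0. Qed.

Lemma nrM (x y : R[i]) : nr (x * y) = nr x * nr y.
Proof. by apply: (@complexI R); rewrite rmorphM /= -!nrE normrM. Qed.

Lemma nr1 : nr (1 : R[i]) = 1.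
Proof. by rewrite /nr normr1. Qed.

Lemma nrV (x : R[i]) : nr x^-1 = (nr x)^-1.
Proof. by apply: (@complexI R); rewrite fmorphV /= -!nrE normfV. Qed.

Lemma nr_real (x : R) : nr (x%:C : R[i]) = `|x|.
Proof. by rewrite /nr normc_def /= expr0n addr0 sqrtr_sqr. Qed.

Lemma nrZ (V : normedModType R[i]) (a : R[i]) (v : V) : nr (a *: v) = nr a * nr v.
Proof. by apply: (@complexI R); rewrite rmorphM /= -!nrE normrZ. Qed.

Lemma ler_Re_nr (z : R[i]) : `|complex.Re z| <= nr z.
Proof.
rewrite /nr normc_def /= -sqrtr_sqr ler_wsqrtr//.
by rewrite lerDl sqr_ge0.
Qed.

Lemma ler_Im_nr (z : R[i]) : `|complex.Im z| <= nr z.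
Proof.
rewrite /nr normc_def /= -sqrtr_sqr ler_wsqrtr//.
by rewrite lerDr sqr_ge0.
Qed.

Lemma ler_nr_ReIm (z : R[i]) : nr z <= `|complex.Re z| + `|complex.Im z|.
Proof.
case: z => a b; rewrite (_ : a +i* b = a%:C + 'i%C * b%:C); last by simpc.
apply: le_trans (ler_nrD _ _) _; rewrite nrM !nr_real /=.
rewrite /nr normc_def /= expr0n add0r expr1n sqrtr1 mul1r !mul0r !mul1r.
by rewrite !(addr0, add0r, oppr0).
Qed.

Lemma nr_ltE (V : normedZmodType R[i]) (v : V) (e : R) :
  (`|v| < e%:C) = (nr v < e).
Proof. by rewrite nrE ltcR. Qed.

Lemma posC_real (e : R[i]) : 0 < e -> exists2 d : R, 0 < d & e = d%:C.
Proof.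
move=> e0; exists (complex.Re e); first by move: e0; rewrite ltcE /= => /andP[].
by rewrite RRe_real // realE ltW.
Qed.

Lemma nbhs_nrP (V : normedModType R[i]) (x : V) (P : set V) :
  (\forall y \near x, P y) <->
  exists2 d : R, 0 < d & forall y, nr (y - x) < d -> P y.
Proof.
split.
- move=> /nbhs_normP[e /= /posC_real[d d0 ->] H]; exists d => // y yx.
  by apply: H => /=; rewrite nr_ltE nrBC.
- move=> [d d0 H]; apply/nbhs_normP; exists d%:C; first by rewrite /= ltcR.
  by move=> y /=; rewrite nr_ltE nrBC => /H.
Qed.

Lemma cvg_nrP (V : normedModType R[i]) (T : Type) (F : set_system T)
    {FF : Filter F} (f : T -> V) (l : V) :
  f @ F --> l <-> forall e : R, 0 < e -> \forall t \near F, nr (f t - l) < e.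
Proof.
split.
- move=> /cvgrPdist_lt H e e0.
  have /H : (0 : R[i]) < e%:C by rewrite ltcR.
  by apply: filterS => t; rewrite nr_ltE nrBC.
- move=> H; apply/cvgrPdist_lt => _ /posC_real[e e0 ->].
  by apply: filterS (H _ e0) => t; rewrite nr_ltE nrBC.
Qed.

End RealNorm.

(** * Integrals over the unit interval *)

Section DyadicMean.
Context {R : realType}.
Local Notation C := (R[i]^o).
Implicit Types (F G : R -> C).

(* The left Riemann sum of F over the subdivision of [0, 1] into 2 ^ n equal
   pieces, in a recursive form that makes [mean_half] immediate. *)
Fixpoint dmean (n : nat) F : C :=
  if n is m.+1 then
    (dmean m (fun t => F (t / 2)) + dmean m (fun t => F ((t + 1) / 2))) / 2
  else F 0.

(** The limits are taken in [R], where completeness is invoked; [mean_cvg] reassembles them into a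
    limit in [C]. *)
Definition mean F : C :=
  limn (fun n => complex.Re (dmean n F)) +i* limn (fun n => complex.Im (dmean n F)).

Definition unit_cont F := forall t, 0 <= t <= 1 -> {for t, continuous F}.

(** A tube lemma for [0, 1] and an arbitrary filter. It is applied to integers tending to infinity,
    for uniform continuity, and to radii tending to a given one. *)
Lemma unit_near (I : Type) (A : set_system I) {FA : Filter A}
    (P : I -> R -> Prop) :
  (forall t : R, 0 <= t <= 1 -> \forall s \near t & i \near A, P i s) ->
  \forall i \near A, forall t : R, 0 <= t <= 1 -> P i t.
Proof.
move=> H.
have := (compact_near_coveringP _).1 (@segment_compact R 0 1) I A P FA.
have Hx (x : R) : `[0, 1]%classic x -> \near x & A, P A x.
  by rewrite /= in_itv /=; exact: H.
move=> /(_ Hx); apply: filterS => i Hi t t01; apply: Hi.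
by rewrite /= in_itv.
Qed.

Lemma half_unit (t : R) : 0 <= t <= 1 -> 0 <= t / 2 <= 1.
Proof. by move=> /andP[? ?]; apply/andP; split; lra. Qed.

Lemma halfS_unit (t : R) : 0 <= t <= 1 -> 0 <= (t + 1) / 2 <= 1.
Proof. by move=> /andP[? ?]; apply/andP; split; lra. Qed.

Lemma half_nr (a b : C) (M : R) : nr a <= M -> nr b <= M -> nr ((a + b) / 2) <= M.
Proof.
move=> aM bM; rewrite nrM nrV.
have -> : nr (2 : R[i]) = 2.
  by rewrite -[2 in LHS](rmorph_nat (real_complex R)) nr_real ger0_norm.
by have := ler_nrD a b; lra.
Qed.

Lemma dmean_ball n F (c : C) (M : R) :
  (forall t, 0 <= t <= 1 -> nr (F t - c) <= M) -> nr (dmean n F - c) <= M.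
Proof.
elim: n F => [|n IH] F H /=; first by apply: H; lra.
rewrite (_ : _ - c = ((dmean n (fun t => F (t / 2)) - c) +
  (dmean n (fun t => F ((t + 1) / 2)) - c)) / 2); last by field.
by apply: half_nr; apply: IH => t t01; apply: H; [exact: half_unit|exact: halfS_unit].
Qed.

(** On each of the 2^N subintervals the finer sum averages values of [F] that differ by at most [e]
    from the value at the left end. The induction rescales [F] to each half, which turns the mesh
    2^-(N+1) into 2^-N. *)
Lemma dmean_close N F (e : R) :
  (forall s t, 0 <= s <= 1 -> 0 <= t <= 1 -> `|s - t| <= 2^-1 ^+ N ->
     nr (F s - F t) <= e) ->
  forall m, nr (dmean (N + m) F - dmean N F) <= e.
Proof.
elim: N F => [|N IH] F H m.
  rewrite add0n /=; apply: dmean_ball => t t01; apply: H => //; first lra.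
  by rewrite subr0 expr0 ger0_norm; lra.
rewrite addSn /=.
rewrite (_ : _ / 2 - _ / 2 =
  ((dmean (N + m) (fun t => F (t / 2)) - dmean N (fun t => F (t / 2))) +
   (dmean (N + m) (fun t => F ((t + 1) / 2)) -
      dmean N (fun t => F ((t + 1) / 2)))) / 2); last by field.
apply: half_nr; apply: IH => s t s01 t01 st; apply: H.
- exact: half_unit.
- exact: half_unit.
- by rewrite -mulrBl normrM [`|2^-1|]ger0_norm ?invr_ge0// exprS; lra.
- exact: halfS_unit.
- exact: halfS_unit.
- rewrite (_ : _ - _ = (s - t) / 2); last by field.
  by rewrite normrM [`|2^-1|]ger0_norm ?invr_ge0// exprS; lra.
Qed.

Lemma unit_cont_unif F (e : R) : unit_cont F -> 0 < e ->
  \forall N \near \oo, forall s t, 0 <= s <= 1 -> 0 <= t <= 1 ->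
    `|s - t| <= 2^-1 ^+ N -> nr (F s - F t) <= e.
Proof.
move=> cF e0.
suff : \forall N \near \oo, forall s, 0 <= s <= 1 -> forall t, 0 <= t <= 1 ->
    `|s - t| <= 2^-1 ^+ N -> nr (F s - F t) <= e.
  by apply: filterS => N H s t s01; exact: H.
apply: unit_near => t0 t001.
have /cvg_nrP/(_ (e / 2)) := cF _ t001.
rewrite divr_gt0// => /(_ isT)/nbhs_ballP[d /= d0 Hd].
have : \forall N \near \oo, 2^-1 ^+ N < d / 2.
  have := @near_infty_natSinv_expn_lt R (PosNum (divr_gt0 d0 (ltr0n _ 2))).
  by apply: filterS => N; rewrite div1r exprVn.
move=> HN.
exists ([set s | `|t0 - s| < d / 2], [set N | 2^-1 ^+ N < d / 2]) => /=.
  split=> //; apply/nbhs_ballP; exists (d / 2) => //=; first by rewrite divr_gt0.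
move=> [s N] /= [st0 Nd] t _ st.
have Fs : nr (F s - F t0) < e / 2 by apply: Hd; rewrite /ball /=; lra.
have Ft : nr (F t - F t0) < e / 2.
  apply: Hd => /=; rewrite /ball/=.
  rewrite (_ : t0 - t = (t0 - s) + (s - t)); last by ring.
  by apply: le_lt_trans (ler_normD _ _) _; lra.
by have := ler_nrBD (F s) (F t0) (F t); rewrite [nr (F t0 - F t)]nrBC; lra.
Qed.

Lemma cvg_complex (u : nat -> C) (l : C) :
  (complex.Re (u n) @[n --> \oo] --> complex.Re l) ->
  (complex.Im (u n) @[n --> \oo] --> complex.Im l) ->
  u n @[n --> \oo] --> l.
Proof.
move=> /cvgrPdist_lt cr /cvgrPdist_lt ci; apply/cvg_nrP => e e0.
have e2 : 0 < e / 2 by rewrite divr_gt0.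
near=> n.
apply: le_lt_trans (ler_nr_ReIm _) _.
have : `|complex.Re l - complex.Re (u n)| < e / 2 by near: n; exact: cr.
have : `|complex.Im l - complex.Im (u n)| < e / 2 by near: n; exact: ci.
rewrite !raddfB /= [`|complex.Re (u n) - _|]distrC [`|complex.Im (u n) - _|]distrC; lra.
Unshelve. all: by end_near. Qed.

Lemma mean_cvg F : unit_cont F -> dmean n F @[n --> \oo] --> mean F.
Proof.
move=> cF.
have H (p : C -> R) : (forall z w, `|p z - p w| <= nr (z - w)) ->
    p (dmean n F) @[n --> \oo] --> limn (fun n => p (dmean n F)).
  move=> Hp; apply/cvg_ex => /=.
  suff : cvgn (fun n => p (dmean n F)) by move=> /cvg_ex.
  apply: cauchy_cvg; apply: cauchy_exP => e e0.
  have e2 : 0 < e / 2 by rewrite divr_gt0.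
  have [N _ HN] := unit_cont_unif cF e2.
  exists (p (dmean N F)); exists N => //= n Nn.
  rewrite /ball /= -(subnKC Nn).
  apply: le_lt_trans (Hp _ _) _; rewrite nrBC.
  apply: (@le_lt_trans _ _ (e / 2)); last by lra.
  by apply: dmean_close; apply: HN => /=.
apply: cvg_complex.
- apply: (H (@complex.Re R)) => z w; rewrite -raddfB; exact: ler_Re_nr.
- apply: (H (@complex.Im R)) => z w; rewrite -raddfB; exact: ler_Im_nr.
Qed.

Lemma mean_uniq F (l : C) :
  unit_cont F -> dmean n F @[n --> \oo] --> l -> mean F = l.
Proof. by move=> cF Fl; apply: (cvg_unique _ (mean_cvg cF) Fl); exact: norm_hausdorff. Qed.

Lemma unit_cont_cst (c : C) : unit_cont (fun=> c).
Proof. by move=> t _; exact: cvg_cst. Qed.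
Arguments unit_cont_cst : clear implicits.

Lemma unit_contD F G :
  unit_cont F -> unit_cont G -> unit_cont (fun t => F t + G t).
Proof. by move=> cF cG t t01; apply: cvgD; [exact: cF|exact: cG]. Qed.

Lemma unit_contM F G :
  unit_cont F -> unit_cont G -> unit_cont (fun t => F t * G t).
Proof. by move=> cF cG t t01; apply: cvgM; [exact: cF|exact: cG]. Qed.

Lemma unit_cont_halfl F : unit_cont F -> unit_cont (fun t => F (t / 2)).
Proof.
move=> cF t t01; apply: (@continuous_comp R R C (fun t => t / 2) F).
  by apply: cvgM; [exact: cvg_id|exact: cvg_cst].
by apply: cF; exact: half_unit.
Qed.

Lemma unit_cont_halfr F : unit_cont F -> unit_cont (fun t => F ((t + 1) / 2)).
Proof.
move=> cF t t01; apply: (@continuous_comp R R C (fun t => (t + 1) / 2) F).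
  apply: cvgM; last exact: cvg_cst.
  by apply: cvgD; [exact: cvg_id|exact: cvg_cst].
by apply: cF; exact: halfS_unit.
Qed.

Lemma cont_real_complex : continuous (fun t : R => t%:C : C).
Proof.
move=> t; apply/cvg_nrP => e e0; apply/nbhs_ballP; exists e => //= s.
by rewrite /ball /= distrC -rmorphB nr_real.
Qed.

Lemma unit_cont_real : unit_cont (fun t => t%:C).
Proof. by move=> t _; exact: cont_real_complex. Qed.

Lemma mean_eq F G : (forall t, 0 <= t <= 1 -> F t = G t) -> mean F = mean G.
Proof.
move=> FG; suff E n : dmean n F = dmean n G.
  by rewrite /mean; congr (limn _ +i* limn _); apply/funext => n; rewrite E.
elim: n F G FG => [|n IH] F G FG /=; first by apply: FG; rewrite lexx ler01.
by congr ((_ + _) / _); apply: IH => t t01; apply: FG;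
  [exact: half_unit|exact: halfS_unit].
Qed.

Lemma meanD F G : unit_cont F -> unit_cont G ->
  mean (fun t => F t + G t) = mean F + mean G.
Proof.
move=> cF cG; apply: mean_uniq; first exact: unit_contD.
have E n : dmean n (fun t => F t + G t) = dmean n F + dmean n G.
  elim: n F G {cF cG} => [|n IH] F G //=; rewrite !IH; by field.
have -> : dmean^~ (fun t => F t + G t) = (fun n => dmean n F + dmean n G).
  by apply/funext => n; exact: E.
by apply: cvgD; exact: mean_cvg.
Qed.

Lemma meanZ (c : C) F : unit_cont F -> mean (fun t => c * F t) = c * mean F.
Proof.
move=> cF; apply: mean_uniq.
  exact: (unit_contM (unit_cont_cst c) cF).
have E n : dmean n (fun t => c * F t) = c * dmean n F.
  elim: n F {cF} => [|n IH] F //=; rewrite !IH; by field.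
have -> : dmean^~ (fun t => c * F t) = (fun n => c * dmean n F).
  by apply/funext => n; exact: E.
by apply: cvgM; [exact: cvg_cst|exact: mean_cvg].
Qed.

Lemma meanB F G : unit_cont F -> unit_cont G ->
  mean (fun t => F t - G t) = mean F - mean G.
Proof.
move=> cF cG; rewrite -[- mean G]mulN1r -(meanZ (-1) cG).
rewrite -(meanD cF (unit_contM (unit_cont_cst (-1)) cG)).
by apply: mean_eq => t _; rewrite mulN1r.
Qed.

Lemma mean_half F : unit_cont F ->
  mean F = (mean (fun t => F (t / 2)) + mean (fun t => F ((t + 1) / 2))) / 2.
Proof.
move=> cF; apply: (mean_uniq cF); rewrite -cvg_shiftS /=.
apply: cvgM; last exact: cvg_cst.
by apply: cvgD; apply: mean_cvg; [exact: unit_cont_halfl|exact: unit_cont_halfr].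
Qed.

Lemma mean_ball F (c : C) (M : R) : unit_cont F ->
  (forall t, 0 <= t <= 1 -> nr (F t - c) <= M) -> nr (mean F - c) <= M.
Proof.
move=> cF H; apply/ler_addgt0Pr => e e0.
have /cvg_nrP/(_ e e0)[N _ /(_ N (leqnn N)) /= HN] := mean_cvg cF.
have := ler_nrBD (mean F) (dmean N F) c.
rewrite [nr (mean F - dmean N F)]nrBC.
by have := dmean_ball N H; lra.
Qed.

Lemma mean_cst (c : C) : mean (fun=> c) = c.
Proof.
apply/eqP; rewrite -subr_eq0 -nr_eq0 eq_le nr_ge0 andbT.
by apply: mean_ball; [exact: unit_cont_cst|move=> t _; rewrite subrr nr0].
Qed.

Lemma ler_mean F (M : R) : unit_cont F ->
  (forall t, 0 <= t <= 1 -> nr (F t) <= M) -> nr (mean F) <= M.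
Proof.
move=> cF H; rewrite -[mean F]subr0; apply: mean_ball => // t t01.
by rewrite subr0; exact: H.
Qed.

(** Self-similarity replaces any computation of sums: halving [0, 1] gives
    [m = (m / 2 + (m + 1) / 2) / 2], whose only solution is 1/2. *)
Lemma mean_real : mean (fun t => t%:C) = 2^-1.
Proof.
set m := mean (fun t => t%:C).
have cR := unit_cont_real.
have h1 : mean (fun t : R => (t / 2)%:C) = 2^-1 * m.
  rewrite -(meanZ 2^-1 cR).
  by apply: mean_eq => t _; rewrite rmorphM fmorphV /= rmorph_nat mulrC.
have h2 : mean (fun t : R => ((t + 1) / 2)%:C) = 2^-1 * (m + 1).
  rewrite -[X in _ + X](mean_cst 1) -(meanD cR (unit_cont_cst 1)).
  rewrite -(meanZ 2^-1 (unit_contD cR (unit_cont_cst 1))).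
  by apply: mean_eq => t _; rewrite rmorphM fmorphV rmorphD /= rmorph_nat mulrC.
have : m = (2^-1 * m + 2^-1 * (m + 1)) / 2.
  by rewrite -h1 -h2; exact: mean_half cR.
move=> H; have : m = 2 * (m - (2^-1 * m + 2^-1 * (m + 1)) / 2) + 2^-1 by field.
by rewrite -H subrr mulr0 add0r.
Qed.

End DyadicMean.
Arguments unit_cont_cst {R} c.

(** * Goursat's lemma *)

Section Goursat.
Context {R : realType}.
Local Notation C := (R[i]^o).
Implicit Types (F : C -> C) (z a b : C).

Definition edge_mean F z a : C := mean (fun t => F (z + t%:C * a)).

(* The integral of F along the boundary of the parallelogram with vertices z,
   z + a, z + a + b, z + b, in this order. *)
Definition rect_int F z a b : C :=
  a * (edge_mean F z a - edge_mean F (z + b) a) +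
  b * (edge_mean F (z + a) b - edge_mean F z b).

Definition cont_edge F z a :=
  forall t : R, 0 <= t <= 1 -> {for z + t%:C * a, continuous F}.

Definition in_rect z a b : set C := fun w =>
  exists x y : R, [/\ 0 <= x <= 1, 0 <= y <= 1 & w = z + x%:C * a + y%:C * b].

Lemma cont_segment z a : continuous (fun t : R => z + t%:C * a).
Proof.
move=> t; apply: cvgD; first exact: cvg_cst.
apply: cvgM; last exact: cvg_cst.
exact: cont_real_complex.
Qed.

Lemma unit_cont_edge F z a :
  cont_edge F z a -> unit_cont (fun t => F (z + t%:C * a)).
Proof.
move=> cF t t01; apply: (@continuous_comp R C C (fun t => z + t%:C * a) F).
  exact: cont_segment.
exact: cF.
Qed.

Lemma edge_mean_half F z a : cont_edge F z a ->
  edge_mean F z a = (edge_mean F z (a / 2) + edge_mean F (z + a / 2) (a / 2)) / 2.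
Proof.
move=> cF; rewrite /edge_mean mean_half; last exact: unit_cont_edge.
congr ((_ + _) / _); apply: mean_eq => t _; congr F.
  by rewrite rmorphM fmorphV /= rmorph_nat; field.
by rewrite rmorphM fmorphV rmorphD /= rmorph_nat; field.
Qed.

(** The mean of an affine function along an edge is its value at the midpoint [z + a / 2]. *)
Lemma edge_mean_near F z a (p q : C) (M : R) : cont_edge F z a ->
  (forall t : R, 0 <= t <= 1 ->
     nr (F (z + t%:C * a) - (p + q * (z + t%:C * a))) <= M) ->
  nr (edge_mean F z a - (p + q * (z + a / 2))) <= M.
Proof.
move=> cF H.
have cR : unit_cont (fun t => q * a * t%:C : C).
  exact: (unit_contM (unit_cont_cst (q * a)) unit_cont_real).
have cA : unit_cont (fun t => (p + q * z) + q * a * t%:C : C).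
  exact: (unit_contD (unit_cont_cst (p + q * z)) cR).
have -> : p + q * (z + a / 2) = mean (fun t => (p + q * z) + q * a * t%:C).
  rewrite (meanD (unit_cont_cst _) cR) mean_cst (meanZ _ unit_cont_real).
  by rewrite mean_real; field.
have cF' := unit_cont_edge cF.
rewrite /edge_mean -(meanB cF' cA); apply: ler_mean.
  by move=> t t01; apply: cvgB; [exact: cF'|exact: cA].
move=> t t01; have := H t t01.
by rewrite (_ : p + q * (z + t%:C * a) = p + q * z + q * a * t%:C)//; ring.
Qed.

(** Exchanging the sides reverses the orientation; cutting along [b] thus reduces to cutting along
    [a]. *)
Lemma rect_int_swap F z a b : rect_int F z b a = - rect_int F z a b.
Proof. by rewrite /rect_int; ring. Qed.

Lemma in_rect_bottom z a b (t : R) : 0 <= t <= 1 -> in_rect z a b (z + t%:C * a).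
Proof. by move=> t01; exists t, 0; rewrite t01 lexx ler01 mul0r addr0. Qed.

Lemma in_rect_top z a b (t : R) : 0 <= t <= 1 -> in_rect z a b (z + b + t%:C * a).
Proof.
by move=> t01; exists t, 1; rewrite t01 lexx ler01 mul1r; split=> //; ring.
Qed.

Lemma in_rect_swap z a b : in_rect z a b = in_rect z b a.
Proof.
by apply/seteqP; split => w [x [y [x01 y01 ->]]]; exists y, x; split => //; ring.
Qed.

Lemma in_rect_left z a b (t : R) : 0 <= t <= 1 -> in_rect z a b (z + t%:C * b).
Proof. by rewrite in_rect_swap; exact: in_rect_bottom. Qed.

Lemma in_rect_right z a b (t : R) : 0 <= t <= 1 -> in_rect z a b (z + a + t%:C * b).
Proof. by rewrite in_rect_swap; exact: in_rect_top. Qed.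

(** An affine integrand integrates to zero: its midpoint values contribute [- a * b * q] on the
    sides parallel to [a] and [a * b * q] on those parallel to [b]. Only the errors on the four
    edges remain. *)
Lemma rect_int_near F z a b (p q : C) (M : R) :
  (forall w, in_rect z a b w -> {for w, continuous F}) ->
  (forall w, in_rect z a b w -> nr (F w - (p + q * w)) <= M) ->
  nr (rect_int F z a b) <= 2 * (nr a + nr b) * M.
Proof.
move=> cF H.
have E (z' a' : C) : (forall t : R, 0 <= t <= 1 -> in_rect z a b (z' + t%:C * a')) ->
    nr (edge_mean F z' a' - (p + q * (z' + a' / 2))) <= M.
  move=> I; apply: edge_mean_near => t t01; [exact: cF (I t t01)|exact: H (I t t01)].
have e1 := E z a (@in_rect_bottom z a b).
have e2 := E (z + b) a (@in_rect_top z a b).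
have e3 := E z b (@in_rect_left z a b).
have e4 := E (z + a) b (@in_rect_right z a b).
set d1 := (X in nr X <= _) in e1; set d2 := (X in nr X <= _) in e2.
set d3 := (X in nr X <= _) in e3; set d4 := (X in nr X <= _) in e4.
have -> : rect_int F z a b = a * (d1 - d2) + b * (d4 - d3).
  by rewrite /rect_int /d1 /d2 /d3 /d4; field.
have h1 := ler_nrD (a * (d1 - d2)) (b * (d4 - d3)).
rewrite !nrM in h1; apply: le_trans h1 _.
have -> : 2 * (nr a + nr b) * M = nr a * (M + M) + nr b * (M + M) by ring.
have h2 := ler_nrB d1 d2; have h3 := ler_nrB d4 d3.
by apply: lerD; apply: ler_wpM2l; rewrite ?nr_ge0//; lra.
Qed.

(** The two halves traverse their common edge in opposite directions, so it cancels. *)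
Lemma rect_int_halve F z a b :
  (forall w, in_rect z a b w -> {for w, continuous F}) ->
  rect_int F z a b = rect_int F z (a / 2) b + rect_int F (z + a / 2) (a / 2) b.
Proof.
move=> cF; rewrite /rect_int.
rewrite (@edge_mean_half F z a); last by move=> t t01; apply: cF; exact: in_rect_bottom.
rewrite (@edge_mean_half F (z + b) a); last by move=> t t01; apply: cF; exact: in_rect_top.
have -> : z + a / 2 + b = z + b + a / 2 by ring.
have -> : z + a / 2 + a / 2 = z + a by field.
by field.
Qed.

Lemma half_complex (x : R) : (x / 2)%:C = x%:C / 2 :> C.
Proof. by rewrite rmorphM fmorphV /= rmorph_nat. Qed.

Lemma in_rect_half z a b : in_rect z (a / 2) b `<=` in_rect z a b.
Proof.
move=> w [x [y [x01 y01 ->]]]; exists (x / 2), y; split => //.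
  exact: half_unit.
by rewrite half_complex; field.
Qed.

Lemma in_rect_halfS z a b : in_rect (z + a / 2) (a / 2) b `<=` in_rect z a b.
Proof.
move=> w [x [y [x01 y01 ->]]]; exists ((x + 1) / 2), y; split => //.
  exact: halfS_unit.
by rewrite half_complex rmorphD /=; field.
Qed.

Lemma rect_int_quarter F z a b :
  (forall w, in_rect z a b w -> {for w, continuous F}) ->
  rect_int F z a b =
    rect_int F z (a / 2) (b / 2) + rect_int F (z + b / 2) (a / 2) (b / 2) +
    (rect_int F (z + a / 2) (a / 2) (b / 2) +
     rect_int F (z + a / 2 + b / 2) (a / 2) (b / 2)).
Proof.
move=> cF; rewrite rect_int_halve//.
have H z' : (forall w, in_rect z' (a / 2) b w -> {for w, continuous F}) ->
    rect_int F z' (a / 2) b =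
      rect_int F z' (a / 2) (b / 2) + rect_int F (z' + b / 2) (a / 2) (b / 2).
  move=> cF'; rewrite -[LHS]opprK -rect_int_swap rect_int_halve.
    by rewrite opprD -!rect_int_swap.
  by rewrite in_rect_swap.
rewrite H; last by move=> w /in_rect_half; exact: cF.
by rewrite H// => w /in_rect_halfS; exact: cF.
Qed.

Lemma nested_dyadic (u : nat -> R) :
  (forall n, u n <= u n.+1) ->
  (forall n, u n.+1 + 2^-1 ^+ n.+1 <= u n + 2^-1 ^+ n) ->
  exists l, forall n, u n <= l <= u n + 2^-1 ^+ n.
Proof.
move=> ui ud.
have um m n : (m <= n)%N -> u m <= u n.
  by move=> /subnK <-; elim: (n - m)%N => // k IH; apply: le_trans IH _; exact: ui.
have udm m n : (m <= n)%N -> u n + 2^-1 ^+ n <= u m + 2^-1 ^+ m.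
  by move=> /subnK <-; elim: (n - m)%N => // k; apply: le_trans; exact: ud.
have h0 n : 0 <= 2^-1 ^+ n :> R by rewrite exprn_ge0 ?invr_ge0.
have ub m n : u m <= u n + 2^-1 ^+ n.
  have [mn|nm] := leP m n.
    by apply: le_trans (um _ _ mn) _; rewrite lerDl.
  by apply: le_trans (udm _ _ (ltnW nm)); rewrite lerDl.
exists (sup (range u)) => n; apply/andP; split.
  by apply: ub_le_sup; [exists (u n + 2^-1 ^+ n) => _ [m _ <-]; exact: ub|exists n].
by apply: ge_sup; [exists (u 0%N), 0%N|move=> _ [m _ <-]; exact: ub].
Qed.

Lemma diff_nr (V W : normedModType R[i]) (f : V -> W) (x : V) :
  differentiable f x -> forall e : R, 0 < e -> exists2 d : R, 0 < d &
    forall h, nr h < d -> nr (f (h + x) - f x - 'd f x h) <= e * nr h.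
Proof.
move=> /diff_locallyP[_ /eqaddoP H] e e0.
have /H /nbhs_nrP[d d0 Hd] : (0 : R[i]) < e%:C by rewrite ltcR.
exists d => // h hd; have := Hd h; rewrite subr0 => /(_ hd) /=.
by rewrite !nrE -rmorphM lecR /= opprD addrA.
Qed.

Lemma diffC_near F z : differentiable F z -> exists q : C,
  forall e : R, 0 < e -> exists2 d : R, 0 < d &
    forall w, nr (w - z) < d -> nr (F w - (F z - q * z + q * w)) <= e * nr (w - z).
Proof.
move=> dF; exists ('d F z 1) => e e0.
have [d d0 H] := diff_nr dF e0; exists d => // w wd.
have E : 'd F z (w - z) = (w - z) * 'd F z 1.
  by rewrite -{1}[w - z]mulr1; exact: linearZ.
have := H _ wd; rewrite subrK E.
by congr (nr _ <= _); ring.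
Qed.

Lemma corner_shift z a b (x y h k : R) :
  z + (x + h)%:C * a + (y + k)%:C * b =
  z + x%:C * a + y%:C * b + h%:C * a + k%:C * b.
Proof. by rewrite !rmorphD /=; ring. Qed.

(** [p] and [p'] are lower left corners of squares of sides 2^-n and 2^-(n+1), the second square
    being one of the four quarters of the first. *)
Definition quarter (n : nat) (p p' : R * R) :=
  let h := 2^-1 ^+ n.+1 in
  (p'.1 = p.1 \/ p'.1 = p.1 + h) /\ (p'.2 = p.2 \/ p'.2 = p.2 + h).

(** [good n p] speaks of the dyadic square with corner [p] and side 2^-n. Since a good quarter is
    only promised for squares inside the unit square, [choice] is applied to an implication with
    premise [inv], and [inv] is propagated along the sequence. *)
Lemma bisection (good : nat -> R * R -> Prop) :
  good 0%N (0, 0) ->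
  (forall n p, 0 <= p.1 -> p.1 + 2^-1 ^+ n <= 1 ->
     0 <= p.2 -> p.2 + 2^-1 ^+ n <= 1 -> good n p ->
     exists2 p', quarter n p p' & good n.+1 p') ->
  exists x y : R, forall n, exists p,
    [/\ 0 <= p.1 <= x, x <= p.1 + 2^-1 ^+ n <= 1,
        0 <= p.2 <= y, y <= p.2 + 2^-1 ^+ n <= 1 & good n p].
Proof.
move=> good0 step.
pose inv n (p : R * R) := [/\ 0 <= p.1, p.1 + 2^-1 ^+ n <= 1, 0 <= p.2,
  p.2 + 2^-1 ^+ n <= 1 & good n p].
have [q|f Hf] := @choice (nat * (R * R))%type (R * R)%type
    (fun q p' => inv q.1 q.2 -> quarter q.1 q.2 p' /\ good q.1.+1 p').
  case: q => n p /=.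
  have [[h1 h2 h3 h4 h5]|?] := pselect (inv n p); last by exists p.
  by have [p' ? ?] := step n p h1 h2 h3 h4 h5; exists p'.
pose P := fix P n := if n is m.+1 then f (m, P m) else (0, 0) : R * R.
have q1 n (x x' : R) : x' = x \/ x' = x + 2^-1 ^+ n.+1 ->
    x <= x' /\ x' + 2^-1 ^+ n.+1 <= x + 2^-1 ^+ n.
  have h0 : 0 <= 2^-1 ^+ n :> R by rewrite exprn_ge0 ?invr_ge0.
  by rewrite exprS; case=> ->; split; lra.
have iP n : inv n (P n).
  elim: n => [|n IH]; first by rewrite /inv /= expr0 add0r lexx.
  have [[/q1[a1 b1] /q1[a2 b2]] g] := Hf (n, P n) IH.
  case: IH => c1 c2 c3 c4 _; split => //.
  - exact: le_trans c1 a1.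
  - exact: le_trans b1 c2.
  - exact: le_trans c3 a2.
  - exact: le_trans b2 c4.
have nP n : quarter n (P n) (P n.+1) by have [] := Hf (n, P n) (iP n).
have [x Hx] : exists x, forall n, (P n).1 <= x <= (P n).1 + 2^-1 ^+ n.
  by apply: nested_dyadic => n; have [/q1[]] := nP n.
have [y Hy] : exists y, forall n, (P n).2 <= y <= (P n).2 + 2^-1 ^+ n.
  by apply: nested_dyadic => n; have [_ /q1[]] := nP n.
exists x, y => n; exists (P n); have /andP[x1 x2] := Hx n; have /andP[y1 y2] := Hy n.
by have [c1 c2 c3 c4 c5] := iP n; split => //; apply/andP; split.
Qed.

(** The bisection acts on parameters in the unit square rather than on points of [C], so [a] and [b]
    may be linearly dependent. *)
Definition sub_rect_int F z a b (n : nat) (p : R * R) : C :=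
  rect_int F (z + p.1%:C * a + p.2%:C * b)
    ((2^-1 ^+ n)%:C * a) ((2^-1 ^+ n)%:C * b).

Lemma in_sub_rect z a b (n : nat) (p : R * R) :
  0 <= p.1 -> p.1 + 2^-1 ^+ n <= 1 -> 0 <= p.2 -> p.2 + 2^-1 ^+ n <= 1 ->
  in_rect (z + p.1%:C * a + p.2%:C * b)
    ((2^-1 ^+ n)%:C * a) ((2^-1 ^+ n)%:C * b) `<=` in_rect z a b.
Proof.
have : 0 <= 2^-1 ^+ n :> R by rewrite exprn_ge0 ?invr_ge0.
move: (2^-1 ^+ n) => s s0 p1 p1s p2 p2s w [x [y [/andP[x0 x1] /andP[y0 y1] ->]]].
exists (p.1 + x * s), (p.2 + y * s); split.
- by apply/andP; split; nra.
- by apply/andP; split; nra.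
- by rewrite !rmorphD !rmorphM /=; ring.
Qed.

Lemma four_max (k a0 a1 a2 a3 : R) : 4 * k <= a0 + a1 + (a2 + a3) ->
  [\/ k <= a0, k <= a1, k <= a2 | k <= a3].
Proof.
move=> H; have [h0|h0] := leP k a0; first by constructor 1.
have [h1|h1] := leP k a1; first by constructor 2.
have [h2|h2] := leP k a2; first by constructor 3.
by constructor 4; lra.
Qed.

Lemma sub_rect_int_quarter F z a b (n : nat) (p : R * R) (c : R) :
  (forall w, in_rect z a b w -> {for w, continuous F}) ->
  0 <= p.1 -> p.1 + 2^-1 ^+ n <= 1 -> 0 <= p.2 -> p.2 + 2^-1 ^+ n <= 1 ->
  c * (2^-1 ^+ n) ^+ 2 <= nr (sub_rect_int F z a b n p) ->
  exists2 p', quarter n p p' &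
    c * (2^-1 ^+ n.+1) ^+ 2 <= nr (sub_rect_int F z a b n.+1 p').
Proof.
move=> cF p1 p1s p2 p2s.
have := rect_int_quarter (fun w (h : in_rect (z + p.1%:C * a + p.2%:C * b)
  ((2^-1 ^+ n)%:C * a) ((2^-1 ^+ n)%:C * b) w) => cF w (in_sub_rect p1 p1s p2 p2s h)).
rewrite -/(sub_rect_int F z a b n p).
set h := 2^-1 ^+ n.+1; have hE : 2^-1 ^+ n = 2 * h by rewrite /h exprS; field.
have E (x : C) : (2^-1 ^+ n)%:C * x / 2 = h%:C * x.
  by rewrite hE rmorphM rmorph_nat; field.
rewrite !E.
pose I q := sub_rect_int F z a b n.+1 q.
have E0 : rect_int F (z + p.1%:C * a + p.2%:C * b) (h%:C * a) (h%:C * b) = I p.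
  by [].
have E1 : rect_int F (z + p.1%:C * a + p.2%:C * b + h%:C * b) (h%:C * a) (h%:C * b) =
    I (p.1, p.2 + h).
  by rewrite /I /sub_rect_int /= -[p.1 in RHS]addr0 corner_shift mul0r addr0.
have E2 : rect_int F (z + p.1%:C * a + p.2%:C * b + h%:C * a) (h%:C * a) (h%:C * b) =
    I (p.1 + h, p.2).
  by rewrite /I /sub_rect_int /= -[p.2 in RHS]addr0 corner_shift mul0r addr0.
have E3 : rect_int F (z + p.1%:C * a + p.2%:C * b + h%:C * a + h%:C * b)
    (h%:C * a) (h%:C * b) = I (p.1 + h, p.2 + h).
  by rewrite /I /sub_rect_int /= corner_shift.
rewrite E0 E1 E2 E3 => -> H.
have H4 : 4 * (c * h ^+ 2) <= nr (I p) + nr (I (p.1, p.2 + h)) +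
    (nr (I (p.1 + h, p.2)) + nr (I (p.1 + h, p.2 + h))).
  have -> : 4 * (c * h ^+ 2) = c * (2^-1 ^+ n) ^+ 2 by rewrite hE; ring.
  apply: le_trans H _; apply: le_trans (ler_nrD _ _) _.
  by apply: lerD; exact: ler_nrD.
have [h0|h0|h0|h0] := four_max H4.
- exact: (ex_intro2 _ _ p (conj (or_introl erefl) (or_introl erefl)) h0).
- exact: (ex_intro2 _ _ (p.1, p.2 + h) (conj (or_introl erefl) (or_intror erefl)) h0).
- exact: (ex_intro2 _ _ (p.1 + h, p.2) (conj (or_intror erefl) (or_introl erefl)) h0).
- exact: (ex_intro2 _ _ (p.1 + h, p.2 + h) (conj (or_intror erefl) (or_intror erefl)) h0).
Qed.

(** If the integral had norm [c > 0], bisection would give parallelograms scaled by [s = 2^-n],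
    shrinking to a point [w0], with integral at least [c * s^2]. Near [w0] the tangent affine map
    approximates [F] up to [e * s * S], so [rect_int_near] bounds the same integral by
    [2 * S^2 * e * s^2]. *)
Lemma goursat F z a b :
  (forall w, in_rect z a b w -> differentiable F w) -> rect_int F z a b = 0.
Proof.
move=> dF; apply/eqP; rewrite -nr_eq0; apply/eqP/le_anti; rewrite nr_ge0 andbT.
rewrite leNgt; apply/negP; set c := nr _ => c0.
have cF w : in_rect z a b w -> {for w, continuous F}.
  by move=> /dF; exact: differentiable_continuous.
have [|n p p1 p1s p2 p2s|x [y Hxy]] := @bisection
    (fun n p => c * (2^-1 ^+ n) ^+ 2 <= nr (sub_rect_int F z a b n p)).
- by rewrite /sub_rect_int /= expr0 expr1n mulr1 !mul0r !addr0 !mul1r.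
- exact: sub_rect_int_quarter.
pose w0 := z + x%:C * a + y%:C * b.
have w0in : in_rect z a b w0.
  have [p [/andP[? ?] /andP[? ?] /andP[? ?] /andP[? ?] _]] := Hxy 0%N.
  by exists x, y; split => //; apply/andP; split; lra.
have [q Hq] := diffC_near (dF _ w0in).
pose S := nr a + nr b.
have S0 : 0 <= S by rewrite addr_ge0 ?nr_ge0.
(* This makes [2 * S^2 * e] equal to [c * S^2 / (2 * (S + 1)^2)], which is less than [c]; adding 1
   to [S] keeps the denominator positive when [S = 0]. *)
pose e := c / (4 * (S + 1) ^+ 2).
have e0 : 0 < e by rewrite divr_gt0// mulr_gt0// exprn_gt0//; lra.
have [d d0 Hd] := Hq _ e0.
have [n Hn] : exists n, 2^-1 ^+ n * S < d.
  have dS : 0 < d / (S + 1) by rewrite divr_gt0//; lra.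
  have [n _ /(_ n (leqnn n)) /= h] := @near_infty_natSinv_expn_lt R (PosNum dS).
  exists n; move: h; rewrite div1r -exprVn ltr_pdivlMr; last by lra.
  have : 0 <= 2^-1 ^+ n :> R by rewrite exprn_ge0 ?invr_ge0.
  by move: (2^-1 ^+ n) => s s0 h; lra.
have [p [/andP[p1 p1x] /andP[p1s ?] /andP[p2 p2y] /andP[p2s ?] cI]] := Hxy n.
have s0 : 0 < 2^-1 ^+ n :> R by rewrite exprn_gt0 ?invr_gt0.
have K : nr (sub_rect_int F z a b n p) <=
    2 * (nr ((2^-1 ^+ n)%:C * a) + nr ((2^-1 ^+ n)%:C * b)) * (e * (2^-1 ^+ n * S)).
  apply: (@rect_int_near F _ _ _ (F w0 - q * w0) q) => [w /in_sub_rect|w].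
    by move=> ?; apply: cF; auto.
  move=> [x' [y' [/andP[x0 x1] /andP[y0 y1] Ew]]].
  have wd : nr (w - w0) <= 2^-1 ^+ n * S.
    move: Ew; rewrite /S; move: (2^-1 ^+ n) s0 p1s p2s => s s0 p1s p2s Ew.
    have -> : w - w0 = (p.1 + x' * s - x)%:C * a + (p.2 + y' * s - y)%:C * b.
      by rewrite Ew /w0 !rmorphB !rmorphD !rmorphM /=; ring.
    apply: le_trans (ler_nrD _ _) _; rewrite !nrM !nr_real mulrDr.
    apply: lerD; apply: ler_wpM2r; rewrite ?nr_ge0// ler_norml; apply/andP; split; nra.
  apply: le_trans (Hd _ (le_lt_trans wd Hn)) _.
  by rewrite ler_wpM2l// ltW.
have := le_trans cI K; rewrite !nrM !nr_real (ger0_norm (ltW s0)) -mulrDr -/S.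
rewrite (_ : _ * _ * (e * _) = (2 * S ^+ 2 * e) * (2^-1 ^+ n) ^+ 2); last by ring.
rewrite ler_pM2r; last by rewrite exprn_gt0.
rewrite (_ : 2 * S ^+ 2 * e = c * (S ^+ 2 / (2 * (S + 1) ^+ 2))); last first.
  by rewrite /e; field; lra.
apply/negP; rewrite -ltNge -[ltRHS]mulr1 ltr_pM2l// ltr_pdivrMr; nra.
Qed.

End Goursat.

(** * Means over circles and Cauchy's formula *)

Section Circle.
Context {R : realType}.
Local Notation C := (R[i]^o).
Implicit Types (h : C -> C) (z w : C) (r : R).

Lemma nr_diff (V W : normedModType R[i]) (f : V -> W) (D : {linear V -> W}) (x : V) :
  continuous D ->
  (forall e : R, 0 < e -> exists2 d : R, 0 < d &
    forall v, nr v < d -> nr (f (v + x) - f x - D v) <= e * nr v) ->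
  differentiable f x.
Proof.
move=> cD H.
have E : f \o shift x = cst (f x) + D +o_0 id.
  apply/eqaddoP => _ /posC_real[e e0 ->]; apply/nbhs_nrP.
  have [d d0 Hd] := H _ e0; exists d => // v; rewrite subr0 => /Hd /=.
  by rewrite !nrE -rmorphM lecR /= opprD addrA.
have dE := diff_unique cD E.
by apply/diff_locallyP; rewrite dE.
Qed.

Lemma near_diffC h z (q : C) :
  (forall e : R, 0 < e -> exists2 d : R, 0 < d &
    forall v, nr v < d -> nr (h (v + z) - h z - v * q) <= e * nr v) ->
  differentiable h z.
Proof.
have lD : linear ( *:%R^~ q : C -> C) by move=> u y w; rewrite scalerDl scalerA.
pose D : {linear C -> C} := HB.pack ( *:%R^~ q : C -> C) (GRing.isLinear.Build _ _ _ _ _ lD).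
move=> H; apply: (@nr_diff _ _ _ D) => //.
exact: scalel_continuous.
Qed.

(** * The complex exponential and the parametrization of circles *)

Definition cexp z : C := (expR (complex.Re z))%:C *
  (cos (complex.Im z) +i* sin (complex.Im z)).

Lemma cexpD z w : cexp (z + w) = cexp z * cexp w.
Proof.
case: z w => [a b] [c d]; rewrite /cexp /= expRD cosD sinD.
by simpc; apply/eqP; rewrite eq_complex /=; apply/andP; split; apply/eqP; ring.
Qed.

Lemma nr_cexp z : nr (cexp z) = expR (complex.Re z).
Proof.
rewrite /cexp nrM nr_real ger0_norm ?expR_ge0// [X in _ * X](_ : _ = 1) ?mulr1//.
by rewrite /nr normc_def /= cos2Dsin2 sqrtr1.
Qed.

Lemma cexp_real (x : R) : cexp x%:C = (expR x)%:C.
Proof. by rewrite /cexp /= cos0 sin0 mulr1. Qed.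

Lemma diff_realP (f : R -> R) (x l : R) : is_derive x 1 f l ->
  forall e : R, 0 < e -> exists2 d : R, 0 < d &
    forall v, `|v| < d -> `|f (v + x) - f x - v * l| <= e * `|v|.
Proof.
move=> df e e0.
have dfx : differentiable f x by apply/derivable1_diffP.
have /diff_locallyP[_ /eqaddoP/(_ e e0)] := dfx.
move=> /nbhs_normP[d /= d0 H]; exists d => // v vd.
have := H v; rewrite /ball_ /= sub0r normrN => /(_ vd).
rewrite diff1E //=.
by rewrite derive1E derive_val /= opprD addrA.
Qed.

(** The addition law reduces the claim to the expansion at 0. There the real exponential, the cosine
    and the sine have first-order expansions with relative error [k], and [nr v < k <= 1 / 8]
    controls the products; the error terms add up to at most [7 * k * nr v], which the factor 8
    covers. *)
Lemma differentiable_cexp z : differentiable cexp z.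
Proof.
apply: (@near_diffC _ _ (cexp z)) => e e0.
have g0 : 0 < nr (cexp z) by rewrite nr_cexp expR_gt0.
pose k := Num.min (1 / 8) (e / (8 * nr (cexp z))).
have k0 : 0 < k by rewrite lt_min; apply/andP; split; rewrite divr_gt0// mulr_gt0.
have k1 : k <= 1 / 8 by rewrite ge_min lexx.
have ke : 8 * k * nr (cexp z) <= e.
  have : k <= e / (8 * nr (cexp z)) by rewrite ge_min lexx orbT.
  by rewrite ler_pdivlMr ?mulr_gt0//; lra.
clearbody k.
have [d1 d10 H1] := diff_realP (is_derive_expR (0 : R)) k0.
have [d2 d20 H2] := diff_realP (is_derive_cos (0 : R)) k0.
have [d3 d30 H3] := diff_realP (is_derive_sin (0 : R)) k0.
exists (Num.min k (Num.min d1 (Num.min d2 d3))); first by rewrite !lt_min k0 d10 d20 d30.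
move=> v; rewrite !lt_min => /and4P[vk v1 v2 v3].
rewrite cexpD (_ : _ - _ - _ = (cexp v - 1 - v) * cexp z); last by ring.
rewrite nrM.
suff : nr (cexp v - 1 - v) <= 8 * k * nr v.
  move=> h; apply: le_trans (ler_wpM2r (nr_ge0 _) h) _.
  by have := nr_ge0 v => ?; nra.
have := ler_Re_nr v; have := ler_Im_nr v.
set N := nr v in vk v1 v2 v3 *; clearbody N.
case: v => x y /= yN xN; rewrite /cexp.
have /H1 : `|x| < d1 by lra.
have /H2 : `|y| < d2 by lra.
have /H3 : `|y| < d3 by lra.
rewrite !addr0 expR0 cos0 sin0 !mulr1 !subr0 oppr0 mulr0 subr0.
have cy : `|cos y| <= 1.
  by rewrite ler_norml cos_le1 cos_geN1.
have sy : `|sin y| <= 1.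
  by rewrite ler_norml sin_le1 sin_geN1.
move=> hs hc he.
apply: le_trans (ler_nr_ReIm _) _ => /=.
rewrite !mul0r !subr0 !addr0.
rewrite (_ : expR x * cos y - 1 - x =
  (expR x - 1 - x) * cos y + (1 + x) * (cos y - 1)); last by ring.
rewrite (_ : expR x * sin y - y =
  (expR x - 1 - x) * sin y + x * (sin y - y) + x * y + (sin y - y)); last by ring.
move: (cos y) (sin y) (expR x - 1 - x) (sin y - y) (cos y - 1) hs hc he cy sy
  => c s E1 S1 c1.
move=> hS hc hE cy sy.
have N0 : 0 <= N by apply: le_trans (normr_ge0 x) xN.
have kN0 : 0 <= k * N by rewrite mulr_ge0// ltW.
have t1 : `|E1 * c| <= k * N.
  rewrite normrM; apply: le_trans (ler_wpM2l (normr_ge0 _) cy) _.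
  by rewrite mulr1; apply: le_trans hE _; rewrite ler_wpM2l// ltW.
have t2 : `|(1 + x) * c1| <= 2 * (k * N).
  rewrite normrM; apply: ler_pM => //.
    by apply: le_trans (ler_normD _ _) _; rewrite normr1; lra.
  by apply: le_trans hc _; rewrite ler_wpM2l// ltW.
have t3 : `|E1 * s| <= k * N.
  rewrite normrM; apply: le_trans (ler_wpM2l (normr_ge0 _) sy) _.
  by rewrite mulr1; apply: le_trans hE _; rewrite ler_wpM2l// ltW.
have t5 : `|S1| <= k * N by apply: le_trans hS _; rewrite ler_wpM2l// ltW.
have t4 : `|x * S1| <= k * N.
  rewrite normrM -[leRHS]mul1r; apply: ler_pM => //; lra.
have t6 : `|x * y| <= k * N.
  by rewrite normrM; apply: ler_pM => //; lra.
have := ler_normD (E1 * c) ((1 + x) * c1).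
have := ler_normD (E1 * s + x * S1 + x * y) S1.
have := ler_normD (E1 * s + x * S1) (x * y).
have := ler_normD (E1 * s) (x * S1).
lra.
Qed.

Definition two_pi_i : C := 0 +i* (2 * pi).

Definition circle_pt (t : R) : C := cexp (t%:C * two_pi_i).

Lemma nr_circle_pt t : nr (circle_pt t) = 1.
Proof. by rewrite nr_cexp /= mul0r mulr0 subr0 expR0. Qed.

Lemma cexp_period z : cexp (z + two_pi_i) = cexp z.
Proof.
rewrite cexpD [X in _ * X](_ : _ = 1) ?mulr1// /cexp /= expR0 mul1r.
by rewrite mulr_natl cos2pi sin2pi.
Qed.

Lemma cont_circle r : continuous (fun t => r%:C * circle_pt t : C).
Proof.
move=> t; apply: cvgM; first exact: cvg_cst.
apply: (@continuous_comp R C C (fun t => t%:C * two_pi_i) cexp).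
  by apply: cvgM; [exact: cont_real_complex|exact: cvg_cst].
exact/differentiable_continuous/differentiable_cexp.
Qed.

(** For [r > 0] this is the integral of [h(z) / z] over |z| = r divided by 2 pi i; the Cauchy kernel
    [1 / (z - l)] therefore appears below as [z / (z - l)]. *)
Definition circle_mean h r : C := mean (fun t => h (r%:C * circle_pt t)).

Lemma nr_circle r t : 0 <= r -> nr (r%:C * circle_pt t) = r.
Proof. by move=> r0; rewrite nrM nr_circle_pt mulr1 nr_real ger0_norm. Qed.

Lemma unit_cont_circle h r : 0 <= r ->
  (forall z, nr z = r -> {for z, continuous h}) ->
  unit_cont (fun t => h (r%:C * circle_pt t)).
Proof.
move=> r0 ch t _; apply: (@continuous_comp R C C (fun t => r%:C * circle_pt t) h).
  exact: cont_circle.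
by apply: ch; rewrite nr_circle.
Qed.

Lemma circle_mean_annulus h (r1 r2 : R) : 0 < r1 -> r1 <= r2 ->
  (forall z, r1 <= nr z <= r2 -> differentiable h z) ->
  circle_mean h r1 = circle_mean h r2.
Proof.
move=> r10 r12 dh; have r20 : 0 < r2 by exact: lt_le_trans r12.
have lr : ln r1 <= ln r2 by rewrite ler_ln.
pose z : C := (ln r1)%:C; pose a : C := (ln r2 - ln r1)%:C.
have G : rect_int (h \o cexp) z a two_pi_i = 0.
  apply: goursat => w [x [y [/andP[x0 x1] /andP[y0 y1] ->]]].
  apply: differentiable_comp; first exact: differentiable_cexp.
  apply: dh; rewrite nr_cexp /= !(mul0r, mulr0, subr0, addr0).
  have e1 : expR (ln r1) = r1 by rewrite lnK ?posrE.
  have e2 : expR (ln r2) = r2 by rewrite lnK ?posrE.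
  by apply/andP; split; [rewrite -[leLHS]e1|rewrite -[leRHS]e2]; rewrite ler_expR; nra.
(* The edges parallel to [a] are exchanged by the period of [cexp] and cancel; the other two
   contribute [two_pi_i] times the difference of the circle means. *)
move: G; rewrite /rect_int.
have -> : edge_mean (h \o cexp) (z + two_pi_i) a = edge_mean (h \o cexp) z a.
  by apply: mean_eq => t _ /=; rewrite addrAC cexp_period.
have -> : edge_mean (h \o cexp) (z + a) two_pi_i = circle_mean h r2.
  apply: mean_eq => t _ /=; rewrite cexpD /z /a -rmorphD /= subrKC.
  by rewrite cexp_real lnK ?posrE.
have -> : edge_mean (h \o cexp) z two_pi_i = circle_mean h r1.
  by apply: mean_eq => t _ /=; rewrite cexpD /z cexp_real lnK ?posrE.
rewrite subrr mulr0 add0r => /eqP; rewrite mulf_eq0 subr_eq0 => /orP[|/eqP->//].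
rewrite eq_complex /= => /andP[_]; rewrite mulf_eq0 pnatr_eq0 /=.
by rewrite gt_eqF// pi_gt0.
Qed.

End Circle.

(** * From circle means to Cauchy's formula and a first-order Taylor estimate *)

Section CauchyFormula.
Context {R : realType}.
Local Notation C := (R[i]^o).
Implicit Types (h u : C -> C) (z w l : C) (r : R).

Lemma cont_nrP (V W : normedModType R[i]) (f : V -> W) (x : V) :
  {for x, continuous f} <-> forall e : R, 0 < e -> exists2 d : R, 0 < d &
    forall y, nr (y - x) < d -> nr (f y - f x) < e.
Proof.
split=> [/cvg_nrP H e /H /nbhs_nrP //|H].
by apply/cvg_nrP => e e0; apply/nbhs_nrP; exact: H.
Qed.

Lemma circle_mean_cont h (rho r0 e : R) :
  (forall z, nr z < rho -> {for z, continuous h}) ->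
  0 <= r0 < rho -> 0 < e ->
  exists2 d : R, 0 < d & forall r, 0 <= r -> `|r - r0| < d ->
    nr (circle_mean h r - circle_mean h r0) <= e.
Proof.
move=> ch /andP[r00 r0rho] e0.
have : \forall r \near r0, forall t : R, 0 <= t <= 1 ->
    nr (h (r%:C * circle_pt t) - h (r0%:C * circle_pt t)) <= e.
  apply: (@unit_near R R (nbhs r0) _ (fun r t =>
    nr (h (r%:C * circle_pt t) - h (r0%:C * circle_pt t)) <= e)) => t0 t001.
  have z0 : nr (r0%:C * circle_pt t0) < rho by rewrite nr_circle.
  have /cvg_nrP/(_ (e / 2)) := ch _ z0.
  rewrite divr_gt0// => /(_ isT) /nbhs_nrP[d d0 Hd].
  have d2 : 0 < d / 2 by rewrite divr_gt0.
  have /cvg_nrP/(_ _ d2) Ht := @cont_circle R r0 t0.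
  exists ([set t | nr (r0%:C * circle_pt t - r0%:C * circle_pt t0) < d / 2],
    [set r | `|r0 - r| < d / 2]).
    by split => //=; apply/nbhs_ballP; exists (d / 2).
  move=> [t r] /= [ht hr].
  have h1 : nr (h (r0%:C * circle_pt t) - h (r0%:C * circle_pt t0)) < e / 2.
    by apply: Hd; lra.
  have h2 : nr (h (r%:C * circle_pt t) - h (r0%:C * circle_pt t0)) < e / 2.
    apply: Hd; apply: le_lt_trans (ler_nrBD _ (r0%:C * circle_pt t) _) _.
    rewrite -mulrBl -rmorphB nrM nr_circle_pt mulr1 nr_real distrC; lra.
  apply: le_trans (ler_nrBD _ (h (r0%:C * circle_pt t0)) _) _.
  by rewrite [nr (h (r0%:C * circle_pt t0) - _)]nrBC; lra.
move=> /nbhs_ballP[d /= d0 Hd].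
exists (Num.min d (rho - r0)); first by rewrite lt_min d0 subr_gt0.
move=> r rp; rewrite lt_min => /andP[rd rr].
have rrho : r < rho by have := ler_norm (r - r0); lra.
have c1 : unit_cont (fun t => h (r%:C * circle_pt t)).
  by apply: unit_cont_circle => // z zr; apply: ch; rewrite zr.
have c2 : unit_cont (fun t => h (r0%:C * circle_pt t)).
  by apply: unit_cont_circle => // z zr; apply: ch; rewrite zr.
rewrite /circle_mean -(meanB c1 c2); apply: ler_mean.
  by move=> t t01; apply: cvgB; [exact: c1|exact: c2].
by apply: Hd; rewrite /ball /= distrC.
Qed.

Lemma circle_mean0 h : circle_mean h 0 = h 0.
Proof.
rewrite /circle_mean -[RHS](mean_cst (h 0)); apply: mean_eq => t _.
by rewrite mul0r.
Qed.

(** Holomorphy is assumed on the open annulus only: the means at [a + m] and [b - m] agree, and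
    [circle_mean_cont] lets [m] tend to 0. This also reaches the radius [a = 0]. *)
Lemma circle_mean_closed h (rho a b : R) :
  (forall z, nr z < rho -> {for z, continuous h}) ->
  0 <= a -> a < b -> b < rho ->
  (forall z, a < nr z < b -> differentiable h z) ->
  circle_mean h a = circle_mean h b.
Proof.
move=> ch a0 ab brho dh.
apply/eqP; rewrite -subr_eq0 -nr_eq0 eq_le nr_ge0 andbT.
apply/ler_addgt0Pr => e e0; rewrite add0r.
have e2 : 0 < e / 2 by rewrite divr_gt0.
have a1 : 0 <= a < rho by rewrite a0 (lt_trans ab).
have b1 : 0 <= b < rho by rewrite brho andbT (le_trans a0)// ltW.
have [d1 d10 H1] := circle_mean_cont ch a1 e2.
have [d2 d20 H2] := circle_mean_cont ch b1 e2.
pose m := Num.min (Num.min (d1 / 2) (d2 / 2)) ((b - a) / 2).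
have m0 : 0 < m.
  by rewrite !lt_min; apply/andP; split; [apply/andP; split|]; rewrite divr_gt0// subr_gt0.
have : m <= (b - a) / 2 by rewrite /m ge_min lexx orbT.
have : m <= d1 / 2 by rewrite /m !ge_min lexx.
have : m <= d2 / 2 by rewrite /m !ge_min lexx orbT.
clearbody m => md2 md1 mab.
have E : circle_mean h (a + m) = circle_mean h (b - m).
  apply: circle_mean_annulus; [lra|lra|].
  by move=> z /andP[z1 z2]; apply: dh; apply/andP; split; lra.
have K1 := H1 (a + m); rewrite addrAC subrr add0r (ger0_norm (ltW m0)) in K1.
have K2 := H2 (b - m); rewrite addrAC subrr add0r normrN (ger0_norm (ltW m0)) in K2.
have {}K1 : nr (circle_mean h (a + m) - circle_mean h a) <= e / 2 by apply: K1; lra.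
have {}K2 : nr (circle_mean h (b - m) - circle_mean h b) <= e / 2 by apply: K2; lra.
apply: le_trans (ler_nrBD _ (circle_mean h (a + m)) _) _.
by rewrite nrBC {2}E; lra.
Qed.

(** Means are compared radially, so a whole exceptional circle costs no more than one point: the
    mean is constant on either side of the radius [s], and continuity carries it across [s] and down
    to the centre. *)
Lemma circle_mean_center h (rho s r : R) :
  (forall z, nr z < rho -> {for z, continuous h}) ->
  (forall z, nr z < rho -> nr z <> s -> differentiable h z) ->
  0 <= s -> 0 <= r < rho -> circle_mean h r = h 0.
Proof.
move=> ch dh s0 /andP[r0 rrho]; rewrite -circle_mean0.
have [rs|sr] := leP r s.
  move: r0; rewrite le_eqVlt => /orP[/eqP <-//|r0].
  apply/esym/(circle_mean_closed ch) => // z /andP[z0 zr].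
  by apply: dh; [exact: lt_trans rrho|move=> zs; lra].
have <- : circle_mean h s = circle_mean h r.
  apply: (circle_mean_closed ch) => // z /andP[z0 zr].
  by apply: dh; [exact: lt_trans rrho|move=> zs; lra].
move: s0; rewrite le_eqVlt => /orP[/eqP <-//|s0].
apply/esym/(circle_mean_closed ch) => //; first exact: lt_trans rrho.
move=> z /andP[z0 zr].
by apply: dh; [lra|move=> zs; lra].
Qed.

Lemma differentiable_kernel l z : z != l -> differentiable (fun z => (z - l)^-1 : C) z.
Proof.
move=> zl; apply: differentiableV; last by rewrite subr_eq0.
exact: differentiableB.
Qed.

Lemma near_eq_diffC h u z (d : R) : 0 < d ->
  (forall w, nr (w - z) < d -> h w = u w) -> differentiable h z -> differentiable u z.
Proof.
move=> d0 hu dh; have [q Hq] := diffC_near dh.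
apply: (@near_diffC _ _ _ q) => e e0; have [d' d'0 H] := Hq e e0.
exists (Num.min d d'); first by rewrite lt_min d0.
move=> v; rewrite lt_min => /andP[vd vd'].
rewrite -!hu ?subrr ?nr0 ?addrK//.
have := H (v + z); rewrite addrK => /(_ vd').
by congr (nr _ <= _); ring.
Qed.

Lemma nr_subl_gt0 l z : nr l < nr z -> z != l.
Proof. by apply: contraTneq => ->; rewrite ltxx. Qed.

Lemma ler_nr_kernel l z : nr l < nr z -> nr ((z - l)^-1 : C) <= (nr z - nr l)^-1.
Proof.
move=> lz; rewrite nrV lef_pV2 ?posrE ?subr_gt0 ?nr_gt0 ?subr_eq0//; last first.
  exact: nr_subl_gt0.
by rewrite lerBlDr; have := ler_nrD (z - l) l; rewrite subrK.
Qed.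

(** The mean is the same on every larger circle, where it is at most the inverse of [r' - nr l]; the
    choice of [r'] makes this at most [e]. *)
Lemma circle_mean_kernel0 l r : nr l < r -> circle_mean (fun z => (z - l)^-1) r = 0.
Proof.
move=> lr; apply/eqP; rewrite -nr_eq0 eq_le nr_ge0 andbT.
apply/ler_addgt0Pr => e e0; rewrite add0r.
have l0 := nr_ge0 l.
pose r' := Num.max r (nr l + e^-1).
have rr' : r <= r' by rewrite le_max lexx.
have er' : nr l + e^-1 <= r' by rewrite le_max lexx orbT.
have r0 : 0 < r by exact: le_lt_trans lr.
rewrite (circle_mean_annulus r0 rr'); last first.
  by move=> z /andP[rz _]; apply: differentiable_kernel; apply: nr_subl_gt0; lra.
have r'0 : 0 <= r' by lra.
apply: ler_mean.
  apply: (@unit_cont_circle _ (fun z => (z - l)^-1)) => // z zr'.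
  by apply/differentiable_continuous; apply: differentiable_kernel; apply: nr_subl_gt0; lra.
move=> t _; apply: le_trans (ler_nr_kernel _) _; rewrite nr_circle//; first lra.
by rewrite -[leRHS]invrK lef_pV2 ?posrE ?invr_gt0//; lra.
Qed.

(* The function k below is continuous on the disc, holomorphic off the circle
   through l, and vanishes at 0; hence its circle means vanish, although its
   differentiability at l is not known. *)
Lemma cauchy_formula u (rho : R) l r :
  (forall z, nr z < rho -> differentiable u z) -> nr l < r < rho ->
  circle_mean (fun z => u z * (z / (z - l))) r = u l.
Proof.
move=> du /andP[lr rrho]; have l0 := nr_ge0 l.
have r0 : 0 <= r by lra.
have [q Hq] := diffC_near (du l (lt_trans lr rrho)).
(* The value at [l] is the limit of the other branch, as [(u z - u l) / (z - l)] tends to [q]. *)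
pose k z : C := if z == l then l * q else (u z - u l) * z / (z - l).
have dk z : nr z < rho -> z != l -> differentiable k z.
  move=> zr zl; apply: (@near_eq_diffC (fun z => (u z - u l) * z / (z - l)) _ _ (nr (z - l))).
  - by rewrite nr_gt0 subr_eq0.
  - move=> w wz; have wl : w != l.
      by apply: contraTneq wz => ->; rewrite nrBC ltxx.
    by rewrite /k (negbTE wl).
  - apply: differentiableM; last exact: differentiable_kernel.
    apply: differentiableM; last exact: ex_diff.
    by apply: differentiableB; [exact: du|exact: differentiable_cst].
have ck z : nr z < rho -> {for z, continuous k}.
  move=> zr; have [->|zl] := eqVneq z l; last exact/differentiable_continuous/dk.
  apply/cont_nrP => e e0.
  have A0 : 0 < 2 * (nr l + 1) by lra.
  have [d d0 Hd] := Hq _ (divr_gt0 e0 A0).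
  have q1 : 0 < 2 * (nr q + 1) by have := nr_ge0 q; lra.
  exists (Num.min (Num.min 1 d) (e / (2 * (nr q + 1)))).
    by rewrite !lt_min ltr01 d0 divr_gt0.
  move=> w; rewrite !lt_min ltr_pdivlMr// => /andP[/andP[w1 wd] wq].
  rewrite /k eqxx; case: eqVneq => [_|wl]; first by rewrite subrr nr0.
  have wl0 : 0 < nr (w - l) by rewrite nr_gt0 subr_eq0.
  have wl' : w - l != 0 by rewrite subr_eq0.
  have := Hd w wd; set E := u w - _ => HE.
  have -> : (u w - u l) * w / (w - l) - l * q = (w - l) * q + w * (E / (w - l)).
    by rewrite /E; field.
  apply: le_lt_trans (ler_nrD _ _) _; rewrite !nrM nrV.
  have HE' : nr E / nr (w - l) <= e / (2 * (nr l + 1)) by rewrite ler_pdivrMr.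
  have wle : nr w <= nr l + 1 by have := ler_nrD (w - l) l; rewrite subrK; lra.
  have : nr w * (nr E / nr (w - l)) <= (nr l + 1) * (e / (2 * (nr l + 1))).
    by apply: ler_pM; rewrite ?nr_ge0// divr_ge0 ?nr_ge0.
  have -> : (nr l + 1) * (e / (2 * (nr l + 1))) = e / 2 by field; lra.
  have := nr_ge0 q; have := nr_ge0 (w - l); nra.
have := @circle_mean_center k rho (nr l) r ck.
have k0 : k 0 = 0.
  rewrite /k; case: eqVneq => [<-|_]; first by rewrite mul0r.
  by rewrite mulr0 mul0r.
rewrite k0 r0 rrho => /(_ _ l0 isT) H.
have {}H : circle_mean k r = 0.
  by apply: H => z zr zl; apply: dk => //; apply: contra_notN zl => /eqP ->.
have nl z : nr z = r -> z != l by move=> zr; apply: nr_subl_gt0; rewrite zr.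
have c1 : unit_cont (fun t => (fun z => (z - l)^-1) (r%:C * circle_pt t) : C).
  apply: (@unit_cont_circle _ (fun z => (z - l)^-1)) => // z zr.
  by apply/differentiable_continuous/differentiable_kernel; exact: nl.
have c2 : unit_cont (fun t => (fun z => u z * (z / (z - l))) (r%:C * circle_pt t) : C).
  apply: (@unit_cont_circle _ (fun z => u z * (z / (z - l)))) => // z zr.
  apply/differentiable_continuous; apply: differentiableM; first by apply: du; rewrite zr.
  apply: differentiableM; first exact: ex_diff.
  by apply: differentiable_kernel; exact: nl.
have c3 := unit_contM (unit_cont_cst l) c1.
have c4 := unit_contD (unit_cont_cst 1) c3.
have c5 := unit_contM (unit_cont_cst (u l)) c4.
(* On the circle [z / (z - l) = 1 + l / (z - l)], and this has mean 1 because the mean of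
   [(z - l)^-1] vanishes. *)
have : circle_mean k r = circle_mean (fun z => u z * (z / (z - l))) r -
    u l * (1 + l * circle_mean (fun z => (z - l)^-1) r).
  rewrite /circle_mean -(meanZ _ c1) -[X in X + mean _](mean_cst 1).
  rewrite -(meanD (unit_cont_cst 1) c3) -(meanZ _ c4) -(meanB c2 c5).
  apply: mean_eq => t _ /=; have zl := nl _ (nr_circle t r0).
  rewrite /k (negbTE zl); move: (r%:C * _) zl => z zl.
  have zl' : z - l != 0 by rewrite subr_eq0.
  by rewrite -{1}(divff zl') -mulrDl subrK -mulrA mulrBl.
rewrite H circle_mean_kernel0// mulr0 addr0 mulr1 => /esym/eqP.
by rewrite subr_eq0 => /eqP.
Qed.

(** Inserting [z / (z - l) = 1 + l / z + l^2 / (z * (z - l))] into Cauchy's formula writes [u l] as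
    a constant, a linear term with coefficient [c1], and [l^2 * E l] with [E] bounded. It remains to
    identify [c1] with the derivative at 0. *)
Lemma taylor1_bound u (rho M r : R) l :
  (forall z, nr z < rho -> differentiable u z) -> 0 < r < rho ->
  (forall z, nr z = r -> nr (u z) <= M) -> nr l < r ->
  nr (u l - u 0 - 'd u 0 l) <= M * nr l ^+ 2 / (r * (r - nr l)).
Proof.
move=> du /andP[r0 rrho] uM lr.
have z0 z : nr z = r -> z != 0 by move=> zr; rewrite -nr_gt0 zr.
have cu : unit_cont (fun t => u (r%:C * circle_pt t)).
  apply: unit_cont_circle; first exact: ltW.
  by move=> z zr; apply/differentiable_continuous/du; rewrite zr.
have cu1 : unit_cont (fun t => (fun z => u z / z) (r%:C * circle_pt t) : C).
  apply: (@unit_cont_circle _ (fun z => u z / z)); first exact: ltW.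
  move=> z zr; apply/differentiable_continuous/differentiableM.
    by apply: du; rewrite zr.
  by apply: differentiableV => //; exact: z0.
pose c1 := circle_mean (fun z => u z / z) r.
pose E v := circle_mean (fun z => u z / (z * (z - v))) r.
have cE v : nr v < r ->
    unit_cont (fun t => (fun z => u z / (z * (z - v))) (r%:C * circle_pt t) : C).
  move=> vr; apply: (@unit_cont_circle _ (fun z => u z / (z * (z - v)))); first exact: ltW.
  move=> z zr; apply/differentiable_continuous/differentiableM.
    by apply: du; rewrite zr.
  apply: differentiableV; first by apply: differentiableM => //; exact: differentiableB.
  apply: mulf_neq0; first exact: z0.
  by rewrite subr_eq0; apply: nr_subl_gt0; rewrite zr.
have EM v : nr v < r -> nr (E v) <= M / (r * (r - nr v)).
  move=> vr; apply: ler_mean; first exact: cE.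
  move=> t _ /=; have zr := nr_circle t (ltW r0).
  rewrite nrM nrV nrM zr; have := uM _ zr; move: (r%:C * _) zr => z zr uz.
  have vz : nr v < nr z by rewrite zr.
  have := ler_nr_kernel vz; rewrite nrV zr => K.
  have M0 : 0 <= M by exact: le_trans (nr_ge0 _) uz.
  apply: ler_pM => //; rewrite ?nr_ge0 ?invr_ge0 ?mulr_ge0 ?nr_ge0 ?(ltW r0)//.
  rewrite !invfM; apply: ler_wpM2l => //; rewrite invr_ge0; exact: ltW.
have F v : nr v < r -> u v = circle_mean u r + v * c1 + v ^+ 2 * E v.
  move=> vr; rewrite -(@cauchy_formula u rho v r du); last by rewrite vr.
  rewrite /E /c1 /circle_mean -(meanZ _ cu1) -(meanZ _ (cE v vr)).
  have k1 := unit_contM (unit_cont_cst v) cu1.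
  have k2 := unit_contM (unit_cont_cst (v ^+ 2)) (cE v vr).
  rewrite -(meanD cu k1) -(meanD (unit_contD cu k1) k2).
  apply: mean_eq => t _ /=; have zr := nr_circle t (ltW r0).
  move: (r%:C * _) zr => z zr; have zn := z0 z zr.
  have vz : z - v != 0 by rewrite subr_eq0; apply: nr_subl_gt0; rewrite zr.
  by field; rewrite vz zn.
have F0 : circle_mean u r = u 0.
  by rewrite (F 0) ?nr0// mul0r expr0n mul0r !addr0.
have D v : 'd u 0 v = v * 'd u 0 1.
  by rewrite -{1}[v]mulr1; exact: linearZ.
have Q : 'd u 0 1 = c1.
  apply/eqP; rewrite eq_sym -subr_eq0 -nr_eq0 eq_le nr_ge0 andbT.
  apply/ler_addgt0Pr => e e0; rewrite add0r.
  have M0 : 0 <= M.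
    by apply: le_trans (nr_ge0 _) (uM r%:C _); rewrite nr_real ger0_norm// ltW.
  have du0 : differentiable u 0 by apply: du; rewrite nr0; lra.
  have [d d0 Hd] := diff_nr du0 (divr_gt0 e0 (ltr0n _ 2)).
  (* The expansion is tested at a small real [x]: the first bound keeps [r - x] at least [r / 2],
     the second puts [x] in the range of [Hd], and the third makes [x * nr (E x)] at most
     [e / 2]. *)
  pose x := Num.min (Num.min (r / 2) (d / 2)) (e * r ^+ 2 / (4 * (M + 1))).
  have x0 : 0 < x.
    rewrite !lt_min !divr_gt0// ?mulr_gt0 ?exprn_gt0//; lra.
  have xr : x <= r / 2 by rewrite /x !ge_min lexx.
  have xd : x <= d / 2 by rewrite /x !ge_min lexx orbT.
  have xM : 4 * (M + 1) * x <= e * r ^+ 2.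
    have : x <= e * r ^+ 2 / (4 * (M + 1)) by rewrite /x !ge_min lexx orbT.
    by rewrite ler_pdivlMr; [rewrite mulrC|lra].
  clearbody x.
  have nx : nr (x%:C : C) = x by rewrite nr_real ger0_norm// ltW.
  have xr' : nr (x%:C : C) < r by rewrite nx; lra.
  have := Hd x%:C; rewrite nx addr0 (D x%:C) => /(_ ltac:(lra)).
  rewrite (F _ xr') F0.
  rewrite (_ : _ - _ - _ = x%:C * (c1 - 'd u 0 1 + x%:C * E x%:C)); last by ring.
  rewrite nrM nx mulrC ler_pM2r// => K.
  have K2 := EM _ xr'; rewrite nx in K2.
  have K3 : nr (x%:C * E x%:C) <= e / 2.
    rewrite nrM nx; apply: le_trans (ler_wpM2l (ltW x0) K2) _.
    rewrite mulrA ler_pdivrMr; last by apply: mulr_gt0; lra.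
    have : M * x <= (M + 1) * x by nra.
    have : r ^+ 2 <= 2 * (r * (r - x)) by rewrite expr2; nra.
    nra.
  apply: le_trans (_ : _ <= nr (c1 - 'd u 0 1 + x%:C * E x%:C) + nr (x%:C * E x%:C)) _.
    by have := ler_nrB (c1 - 'd u 0 1 + x%:C * E x%:C) (x%:C * E x%:C); rewrite addrK.
  lra.
rewrite D Q (F _ lr) F0.
rewrite (_ : _ - _ - _ = l ^+ 2 * E l); last by ring.
rewrite expr2 !nrM -mulrA [M * _]mulrC expr2 -!mulrA.
by do 2 (apply: ler_wpM2l; first exact: nr_ge0); exact: EM.
Qed.

End CauchyFormula.

(** * Holomorphic dependence on parameters *)

Section SeveralVariables.
Context {R : realType} {V : normedModType R[i]}.
Local Notation C := (R[i]^o).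
Implicit Types (f : V -> C) (U : set V) (v w : V).

Lemma differentiable_subr (W : normedModType R[i]) (a x : W) :
  differentiable (fun y => y - a) x.
Proof.
apply: (@differentiableB _ _ _ id (cst a)); last exact: differentiable_cst.
exact: ex_diff.
Qed.

(** Compactness with respect to the filter of positive reals tending to 0, phrased with explicit
    thresholds. *)
Lemma compact_uniform (T : topologicalType) (K : set T) (P : R -> T -> Prop) :
  compact K ->
  (forall t, K t -> exists2 d : R, 0 < d &
     \forall s \near t, forall x, 0 < x < d -> P x s) ->
  exists2 d : R, 0 < d & forall x, 0 < x < d -> forall t, K t -> P x t.
Proof.
move=> /compact_near_coveringP cK H.
have := cK R (0^'+) (fun x t => P x t) _.
have Hx t : K t -> \forall t' \near t & x \near 0^'+, P x t'.
  move=> /H[d d0 Hd].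
  exists ([set s | forall x, 0 < x < d -> P x s], [set x | 0 < x < d]).
    split => //=; apply/nbhs_ballP; exists d => //= x.
    rewrite /ball /= sub0r normrN => xd x0.
    by rewrite x0 (le_lt_trans (ler_norm _) xd).
  by move=> [s x] /= [h xd]; exact: h.
move=> /(_ _ Hx) /nbhs_ballP[d /= d0 Hd]; exists d => // x /andP[x0 xd].
by apply: Hd => //; rewrite /ball /= sub0r normrN gtr0_norm.
Qed.

Lemma unit_uniform (P : R -> R -> Prop) :
  (forall t : R, 0 <= t <= 1 -> exists2 d : R, 0 < d &
     \forall s \near t, forall x, 0 < x < d -> P x s) ->
  exists2 d : R, 0 < d & forall x, 0 < x < d -> forall t, 0 <= t <= 1 -> P x t.
Proof.
move=> H.
have [|d d0 Hd] := @compact_uniform R _ P (@segment_compact R 0 1).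
  by move=> t; rewrite /= in_itv; exact: H.
by exists d => // x xd t t01; apply: Hd => //; rewrite /= in_itv.
Qed.

Lemma open_nr U v : open U -> U v -> exists2 d : R, 0 < d &
  forall w, nr (w - v) < d -> U w.
Proof. by move=> oU Uv; apply/nbhs_nrP; exact: open_nbhs_nbhs. Qed.

Lemma locally_uniform_bound f U (s : R -> V) : open U ->
  (forall v, U v -> {for v, continuous f}) ->
  (forall t, 0 <= t <= 1 -> U (s t) /\ {for t, continuous s}) ->
  exists d M : R, 0 < d /\ forall t, 0 <= t <= 1 ->
    forall v, nr v < d -> U (v + s t) /\ nr (f (v + s t)) <= M.
Proof.
move=> oU cf Us.
(* One parameter serves both as radius and, through its inverse, as bound, so that a single use of
   compactness yields both. *)
have [|d d0 Hd] := @unit_uniform (fun d t =>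
    forall v, nr v < d -> U (v + s t) /\ nr (f (v + s t)) <= d^-1).
  move=> t /Us[Ut ct]; have [d1 d10 H1] := open_nr oU Ut.
  have /cont_nrP/(_ _ ltr01)[d2 d20 H2] := cf _ Ut.
  pose M := nr (f (s t)) + 1.
  have M0 : 0 < M by have := nr_ge0 (f (s t)); rewrite /M; lra.
  pose d := Num.min (Num.min (d1 / 2) (d2 / 2)) M^-1.
  have d0 : 0 < d by rewrite !lt_min invr_gt0 M0 !divr_gt0.
  have dd1 : d <= d1 / 2 by rewrite /d !ge_min lexx.
  have dd2 : d <= d2 / 2 by rewrite /d !ge_min lexx orbT.
  have dM : d <= M^-1 by rewrite /d !ge_min lexx orbT.
  exists d => //; have /cvg_nrP/(_ _ d0) := ct.
  apply: filterS => t' tt' x /andP[x0 xd] v vx.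
  have vs : nr (v + s t' - s t) < 2 * d.
    by rewrite -addrA; apply: le_lt_trans (ler_nrD _ _) _; lra.
  split; first by apply: H1; lra.
  have h2 : nr (f (v + s t') - f (s t)) < 1 by apply: H2; lra.
  have := ler_nrD (f (v + s t') - f (s t)) (f (s t)); rewrite subrK => h3.
  have xM : M <= x^-1.
    rewrite -[M]invrK lef_pV2 ?posrE ?invr_gt0//; lra.
  by move: xM; rewrite /M; lra.
exists (d / 2), (d / 2)^-1; split; first by rewrite divr_gt0.
by move=> t t01 v vd; apply: Hd => //; apply/andP; split; lra.
Qed.

Lemma diff_line f v w : differentiable f v ->
  differentiable (fun l : C => f (l *: w + v)) 0 /\
  'd (fun l : C => f (l *: w + v)) 0 1 = 'd f v w.
Proof.
move=> df.
have d1 : is_diff (0 : C) (fun l : C => l *: w + v) (fun l : C => l *: w + 0).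
  exact: is_diffD.
have df' : differentiable f ((fun l : C => l *: w + v) 0) by rewrite /= scale0r add0r.
have dl : differentiable (fun l : C => l *: w + v) 0 by exact: ex_diff.
split; first exact: (differentiable_comp dl df').
rewrite (_ : (fun l : C => f (l *: w + v)) = f \o (fun l : C => l *: w + v))//.
by rewrite (diff_comp dl df') /= diff_val /= scale0r add0r scale1r addr0.
Qed.

(** On the complex line through [v] in direction [h], [taylor1_bound] at the parameter 1 with
    [r = d / (2 * nr h) >= 2] gives at most [M / (r * (r - 1)) <= 2 * M / r^2]. The constant depends
    on [M] and [d] only, which makes the estimate uniform along a path. *)
Lemma diff_remainder f v (d M : R) :
  (forall h, nr h < d -> differentiable f (h + v) /\ nr (f (h + v)) <= M) ->
  forall h, nr h <= d / 4 ->
    nr (f (h + v) - f v - 'd f v h) <= 8 * M / d ^+ 2 * nr h ^+ 2.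
Proof.
move=> H h hd.
have [->|h0] := eqVneq h 0.
  by rewrite add0r subrr linear0 subr0 !nr0 expr0n /= mulr0.
have n0 : 0 < nr h by rewrite nr_gt0.
have d0 : 0 < d by lra.
have dv : differentiable f v by have [] := H 0; rewrite ?nr0 ?add0r.
have [_ D1] := diff_line h dv.
pose u (l : C) := f (l *: h + v).
pose r := d / (2 * nr h).
have rE : r * nr h = d / 2 by rewrite /r; field; lra.
have r2 : 2 <= r by rewrite ler_pdivlMr; lra.
have B : nr (u 1 - u 0 - 'd u 0 1) <= M * nr (1 : C) ^+ 2 / (r * (r - nr (1 : C))).
  apply: (@taylor1_bound R u (d / nr h)).
  - move=> z zd.
    have zh : nr (z *: h) < d by rewrite nrZ -ltr_pdivlMr.
    have [du _] := diff_line h (H _ zh).1.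
    have E : u = (fun l : C => f (l *: h + (z *: h + v))) \o (fun l => l - z).
      by apply/funext => l; rewrite /u /= scalerBl addrA subrK.
    have dz : differentiable (fun l : C => l - z) z by exact: differentiable_subr.
    have du' : differentiable (fun l : C => f (l *: h + (z *: h + v))) (z - z).
      by rewrite (subrr z); exact: du.
    by rewrite E; exact: (differentiable_comp dz du').
  - apply/andP; split; first lra.
    by rewrite ltr_pdivlMr// rE; lra.
  - move=> z zr; apply: (H _ _).2; rewrite nrZ zr rE; lra.
  - by rewrite nr1; lra.
move: B; rewrite D1 nr1 /u scale1r scale0r add0r expr1n mulr1 => B.
apply: le_trans B _.
have M0 : 0 <= M.
  by apply: le_trans (nr_ge0 (f (0 + v))) _; apply: (H 0 _).2; rewrite nr0.
rewrite (_ : 8 * M / d ^+ 2 * nr h ^+ 2 = M * (2 / r ^+ 2)); last first.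
  by rewrite /r; field; lra.
apply: ler_wpM2l => //; rewrite -[leLHS]mul1r ler_pdivrMr; last by apply: mulr_gt0; lra.
rewrite mulrAC ler_pdivlMr; last by rewrite exprn_gt0; lra.
by rewrite expr2; nra.
Qed.

Lemma linear_bounded_cont (W W' : normedModType R[i]) (D : {linear W -> W'}) (d K : R) :
  0 < d -> (forall x, nr x <= d -> nr (D x) <= K) -> continuous D.
Proof.
move=> d0 H; apply: continuousfor0_continuous; apply/cont_nrP => e e0.
have K0 : 0 <= K by apply: le_trans (nr_ge0 (D 0)) (H 0 _); rewrite nr0 ltW.
pose s := e / (K + 1); have s0 : 0 < s by rewrite divr_gt0; lra.
exists (d * s); first exact: mulr_gt0.
move=> y; rewrite subr0 linear0 subr0 => yd.
have sC : s%:C != 0 :> R[i] by rewrite (inj_eq (@complexI R) s 0) gt_eqF.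
have : nr (D (s%:C^-1 *: y)) <= K.
  apply: H; rewrite nrZ nrV nr_real gtr0_norm// mulrC ler_pdivrMr//; exact: ltW.
rewrite linearZ /= nrZ nrV nr_real gtr0_norm// mulrC ler_pdivrMr// => h.
apply: le_lt_trans h _; rewrite /s mulrA ltr_pdivrMr; nra.
Qed.

(** The derivative is the mean of the derivatives: [diff_remainder] bounds all remainders by
    [A * nr h^2] with [A] independent of [t], and such a bound survives the mean. *)
Lemma differentiable_mean_global f (s : R -> V) (k : R -> C) (d M K : R) : 0 < d ->
  continuous s ->
  (forall t h, nr h < d -> differentiable f (h + s t) /\ nr (f (h + s t)) <= M) ->
  unit_cont k -> (forall t, 0 <= t <= 1 -> nr (k t) <= K) ->
  differentiable (fun w => mean (fun t => f (w + s t) * k t)) 0.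
Proof.
move=> d0 cs H ck kK.
have M0 : 0 <= M.
  by apply: le_trans (nr_ge0 (f (0 + s 0))) _; apply: (H 0 0 _).2; rewrite nr0.
have K0 : 0 <= K by apply: le_trans (nr_ge0 _) (kK 0 _); rewrite lexx ler01.
pose A := 8 * M / d ^+ 2.
have A0 : 0 <= A by rewrite divr_ge0// ?exprn_ge0 ?mulr_ge0// ltW.
have rem t h : nr h <= d / 4 ->
    nr (f (h + s t) - f (s t) - 'd f (s t) h) <= A * nr h ^+ 2.
  by move=> hd; apply: (diff_remainder (H t)).
have cf h : nr h < d -> continuous (fun t => f (h + s t)).
  move=> hd t; apply: (@continuous_comp R V C (fun t => h + s t) f).
    by apply: cvgD; [exact: cvg_cst|exact: cs].
  by apply/differentiable_continuous; exact: (H t h hd).1.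
(* For fixed small [x], the quotient [(f (x h + s t) - f (s t)) / x] is continuous in [t] and within
   [A * x * nr h^2] of the derivative, uniformly in [t]; the derivative is thus a uniform limit of
   continuous functions. *)
have cdf h : continuous (fun t => 'd f (s t) h : C).
  move=> t; apply/cvg_nrP => e e0.
  have h0 := nr_ge0 h.
  (* The first bound brings [x h] within reach of [rem]; the second gives
     [A * nr (x h)^2 <= x * e / 8], so that two remainders and two increments of [f] below
     [x * e / 4] stay below [x * e]. *)
  pose x := Num.min (d / (8 * (nr h + 1))) (e / (8 * (A + 1) * (nr h + 1) ^+ 2)).
  have x0 : 0 < x.
    rewrite lt_min; apply/andP; split; rewrite divr_gt0 ?mulr_gt0 ?exprn_gt0//; lra.
  have x1 : x * (8 * (nr h + 1)) <= d.
    rewrite -ler_pdivlMr; last lra.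
    by rewrite /x ge_min lexx.
  have x2 : x * (8 * (A + 1) * (nr h + 1) ^+ 2) <= e.
    rewrite -ler_pdivlMr; first by rewrite /x ge_min lexx orbT.
    by rewrite !mulr_gt0 ?exprn_gt0//; lra.
  clearbody x.
  have nx : nr (x%:C *: h) = x * nr h by rewrite nrZ nr_real gtr0_norm.
  have xd : nr (x%:C *: h) <= d / 4 by rewrite nx; nra.
  have xd' : nr (x%:C *: h) < d by lra.
  have xe0 : 0 < x * e / 4 by rewrite divr_gt0// mulr_gt0.
  have B t' := rem t' _ xd.
  have AX : A * nr (x%:C *: h) ^+ 2 <= x * e / 8.
    rewrite nx exprMn; have : 0 <= nr h ^+ 2 by exact: exprn_ge0.
    have : nr h ^+ 2 <= (nr h + 1) ^+ 2 by rewrite !expr2; nra.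
    move: (nr h ^+ 2) ((nr h + 1) ^+ 2) x2 => p q x2 pq p0.
    have : A * p <= (A + 1) * q by nra.
    rewrite expr2; nra.
  have /cvg_nrP/(_ _ xe0) C1 := cf _ xd' t.
  have nr0d : nr (0 : V) < d by rewrite nr0.
  have /cvg_nrP/(_ _ xe0) C2 := cf 0 nr0d t.
  near=> t'.
  have c1 : nr (f (x%:C *: h + s t') - f (x%:C *: h + s t)) < x * e / 4.
    by near: t'.
  have c2 : nr (f (0 + s t') - f (0 + s t)) < x * e / 4 by near: t'.
  rewrite !add0r in c2.
  have E z : 'd f z (x%:C *: h) = x%:C * 'd f z h by exact: linearZ.
  have := B t; have := B t'; rewrite !E.
  set a1 := f (_ + s t') in c1 *; set a2 := f (_ + s t) in c1 *.
  move: (f (s t')) (f (s t)) ('d f (s t') h) ('d f (s t) h) c2 => b1 b2 l1 l2 c2 h1 h2.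
  rewrite -(ltr_pM2l x0).
  have -> : x * nr (l1 - l2) = nr ((a1 - a2) - (b1 - b2) -
     ((a1 - b1 - x%:C * l1) - (a2 - b2 - x%:C * l2)) : C).
    rewrite -[x in LHS]gtr0_norm// -nr_real -nrM; congr nr; ring.
  have := ler_nrB ((a1 - a2) - (b1 - b2)) ((a1 - b1 - x%:C * l1) - (a2 - b2 - x%:C * l2)).
  have := ler_nrB (a1 - a2) (b1 - b2).
  have := ler_nrB (a1 - b1 - x%:C * l1) (a2 - b2 - x%:C * l2).
  move=> g1 g2 g3; apply: le_lt_trans g3 _; lra.
have ucd h : unit_cont (fun t => 'd f (s t) h * k t).
  exact: (unit_contM (fun t _ => cdf h t) ck).
have ucf h : nr h < d -> unit_cont (fun t => f (h + s t) * k t).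
  by move=> hd; exact: (unit_contM (fun t _ => cf h hd t) ck).
pose D0 h : C := mean (fun t => 'd f (s t) h * k t).
have lD : linear D0.
  move=> a x y; rewrite /D0 -[a *: mean _]/(a * mean _) -(meanZ a (ucd x)).
  rewrite -(meanD (unit_contM (unit_cont_cst a) (ucd x)) (ucd y)).
  by apply: mean_eq => t _; rewrite linearP mulrDl -mulrA.
pose D : {linear V -> C} := HB.pack D0 (GRing.isLinear.Build _ _ _ _ _ lD).
(* Two values of [f] account for [2 * M], and the remainder is at most [M / 2] because
   [nr h <= d / 4]. This bound yields the continuity of [D], which is not automatic for a linear map
   on a general normed space. *)
have dfM t h : nr h <= d / 4 -> nr ('d f (s t) h) <= 3 * M.
  move=> hd; have h1 := rem t h hd.
  have hd' : nr h < d by lra.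
  have := (H t h hd').2; have := (H t 0); rewrite nr0 => /(_ d0)[_]; rewrite add0r => f1 f2.
  have h2 := ler_nrB (f (h + s t) - f (s t)) (f (h + s t) - f (s t) - 'd f (s t) h).
  rewrite opprB addrCA subrr addr0 in h2.
  have h3 := ler_nrB (f (h + s t)) (f (s t)).
  have h4 : A * nr h ^+ 2 <= M / 2.
    rewrite /A mulrAC ler_pdivrMr ?exprn_gt0//.
    have : nr h ^+ 2 <= d ^+ 2 / 16 by have := nr_ge0 h; rewrite !expr2; nra.
    move: (nr h ^+ 2) => q; nra.
  lra.
have cD : continuous D.
  apply: (@linear_bounded_cont _ _ D (d / 4) (3 * M * K)); first by rewrite divr_gt0.
  move=> w wd; apply: ler_mean; first exact: ucd.
  by move=> t t01; rewrite nrM; apply: ler_pM; rewrite ?nr_ge0 ?dfM ?kK.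
apply: (nr_diff cD) => e e0.
pose e' := e / (A * K + 1).
have AK : 0 <= A * K by exact: mulr_ge0.
have e'0 : 0 < e' by rewrite divr_gt0; lra.
have e'E : e' * (A * K + 1) = e by rewrite /e'; field; lra.
clearbody e'.
exists (Num.min (d / 4) e'); first by rewrite lt_min e'0 divr_gt0.
move=> v; rewrite lt_min addr0 => /andP[vd ve].
have vd' : nr v < d by lra.
rewrite -(meanB (ucf v vd') (ucf 0 _)); last by rewrite nr0.
have c1 : unit_cont (fun t => f (v + s t) * k t - f (0 + s t) * k t).
  by move=> t t01; apply: cvgB; apply: ucf => //; rewrite nr0.
rewrite /= /D0 -(meanB c1 (ucd v)).
apply: le_trans (_ : _ <= A * nr v ^+ 2 * K) _; last first.
  have := nr_ge0 v => v0; rewrite expr2.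
  rewrite (_ : A * (nr v * nr v) * K = (A * K * nr v) * nr v); last by ring.
  by apply: ler_wpM2r => //; nra.
apply: ler_mean; first by move=> t t01; apply: cvgB; [exact: c1|exact: ucd].
move=> t t01; rewrite add0r -!mulrBl nrM; apply: ler_pM; rewrite ?nr_ge0 ?kK//.
by apply: rem; exact: ltW.
Unshelve. all: by end_near. Qed.

End SeveralVariables.

(** * Means of translates along a path, and extension along one disc *)

Section MeanOfTranslates.
Context {R : realType}.
Local Notation C := (R[i]^o).

Lemma nr_open (V : normedModType R[i]) (A : set V) :
  (forall v, A v -> exists2 d : R, 0 < d & forall w, nr (w - v) < d -> A w) -> open A.
Proof. by move=> H; rewrite openE => v /H h; exact: (iffRL (nbhs_nrP v A) h). Qed.

Lemma open_nr_ball (V : normedModType R[i]) (p : V) (r : R) :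
  open [set w | nr (w - p) < r].
Proof.
apply: nr_open => v /= vr; exists (r - nr (v - p)); first by rewrite subr_gt0.
by move=> y yv; have := ler_nrBD y v p; lra.
Qed.

(** A retraction of the line onto [0, 1]: composing a path with it turns hypotheses on [0, 1] into
    hypotheses for all real [t], the form that [differentiable_mean_global] takes. *)
Definition unit_clamp (t : R) : R := if t <= 0 then 0 else if 1 <= t then 1 else t.

Lemma unit_clamp_itv t : 0 <= unit_clamp t <= 1.
Proof.
rewrite /unit_clamp; case: (leP t 0) => t0; first by rewrite lexx ler01.
by case: (leP 1 t) => t1; rewrite ?lexx ?ler01// !ltW.
Qed.

Lemma unit_clamp_id t : 0 <= t <= 1 -> unit_clamp t = t.
Proof.
move=> /andP[t0 t1]; rewrite /unit_clamp; case: (leP t 0) => t0'; first by lra.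
by case: (leP 1 t) => t1'//; lra.
Qed.

Lemma continuous_unit_clamp : continuous unit_clamp.
Proof.
move=> t; apply/cvgrPdist_lt => e e0; apply/nbhs_ballP; exists e => //= s.
rewrite /ball /=; apply: le_lt_trans.
have := ler_norm (t - s); have := ler_norm (s - t); rewrite [`|s - t|]distrC.
move: `|t - s| => N h1 h2; rewrite ler_norml /unit_clamp.
by case: (leP t 0) => ?; case: (leP 1 t) => ?; case: (leP s 0) => ?;
  case: (leP 1 s) => ?; apply/andP; split; lra.
Qed.

(** An instance of [locally_uniform_bound], with the identity as function and [k] as path. *)
Lemma unit_cont_bounded (k : R -> C) : unit_cont k ->
  exists K : R, forall t, 0 <= t <= 1 -> nr (k t) <= K.
Proof.
move=> ck.
have [] := @locally_uniform_bound R C id setT k openT.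
- by move=> v _; exact: cvg_id.
- by move=> t t01; split => //; exact: ck.
move=> d [K [d0 H]]; exists K => t t01.
by have := (H t t01 0 _).2; rewrite nr0 add0r; apply.
Qed.

Lemma differentiable_mean (V : normedModType R[i]) (f : V -> C) (U : set V)
    (s : R -> V) (k : R -> C) (w0 : V) :
  open U -> (forall v, U v -> differentiable f v) ->
  (forall t, 0 <= t <= 1 -> U (w0 + s t) /\ {for t, continuous s}) ->
  unit_cont k ->
  differentiable (fun w => mean (fun t => f (w + s t) * k t)) w0.
Proof.
move=> oU df Us ck; have [K kK] := unit_cont_bounded ck.
(* The base point is absorbed into the path, so that differentiation takes place at 0; clamping
   leaves the mean unchanged. *)
pose s1 t := w0 + s (unit_clamp t).
have cs1 : continuous s1.
  move=> t; apply: cvgD; first exact: cvg_cst.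
  apply: (@continuous_comp R R V unit_clamp s); first exact: continuous_unit_clamp.
  exact: (Us _ (unit_clamp_itv t)).2.
have [|t t01|d [M [d0 H]]] := @locally_uniform_bound R V f U s1 oU.
- by move=> v /df; exact: differentiable_continuous.
- by split; [exact: (Us _ (unit_clamp_itv t)).1|exact: cs1].
have H1 t h : nr h < d -> differentiable f (h + s1 t) /\ nr (f (h + s1 t)) <= M.
  have -> : s1 t = s1 (unit_clamp t).
    by rewrite /s1 (unit_clamp_id (unit_clamp_itv t)).
  by move=> hd; have [/df] := H _ (unit_clamp_itv t) _ hd.
have D := differentiable_mean_global d0 cs1 H1 ck kK.
have -> : (fun w => mean (fun t => f (w + s t) * k t)) =
    (fun w => mean (fun t => f (w + s1 t) * k t)) \o (fun w => w - w0).
  apply/funext => w /=; apply: mean_eq => t t01.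
  by rewrite /s1 unit_clamp_id// addrA subrK.
by apply: differentiable_comp; [exact: differentiable_subr|rewrite subrr].
Qed.

Lemma compact_disc (r : R) : compact [set z : C | nr z <= r].
Proof.
pose g (p : R * R) : C := p.1%:C + 'i%C * p.2%:C.
have cg : continuous g.
  move=> p; apply: cvgD.
    apply: (@continuous_comp _ R C fst (fun t => t%:C)); first exact: cvg_fst.
    exact: cont_real_complex.
  apply: cvgM; first exact: cvg_cst.
  apply: (@continuous_comp _ R C snd (fun t => t%:C)); first exact: cvg_snd.
  exact: cont_real_complex.
apply: (@subclosed_compact _ _ (g @` (`[- r, r]%classic `*` `[- r, r]%classic))).
- rewrite -[X in closed X]setCK; apply: open_closedC.
  apply: nr_open => z /= /negP; rewrite -ltNge => rz.
  exists (nr z - r); first by rewrite subr_gt0.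
  move=> y yz; apply/negP; rewrite -ltNge.
  by have := ler_nrBD z y 0; rewrite !subr0 nrBC; lra.
- apply: continuous_compact; first exact: continuous_subspaceT.
  by apply: compact_setX; exact: segment_compact.
- move=> z /= zr; exists (complex.Re z, complex.Im z); last by rewrite /g -complexE.
  have := ler_Re_nr z; have := ler_Im_nr z; rewrite !ler_norml => /andP[? ?] /andP[? ?].
  by split; rewrite /= in_itv /=; apply/andP; split; lra.
Qed.

(** The ball is the union of the segments that join its centre to its points. *)
Lemma connected_nr_ball (V : normedModType R[i]) (p : V) (r : R) : 0 < r ->
  connected [set w | nr (w - p) < r].
Proof.
move=> r0.
pose seg w (t : R) := p + t%:C *: (w - p).
have -> : [set w | nr (w - p) < r] =
    \bigcup_(w in [set w | nr (w - p) < r]) seg w @` `[0, 1]%classic.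
  apply/seteqP; split => [w wr|w [v /= vr [t]]].
    by exists w => //; exists 1; rewrite /= ?in_itv /= ?ler01 ?lexx// /seg scale1r subrKC.
  rewrite in_itv /= => /andP[t0 t1] <-; rewrite /seg addrC addKr nrZ nr_real ger0_norm//.
  by have := nr_ge0 (v - p); nra.
apply: bigcup_connected.
  exists p => w _; exists 0; first by rewrite /= in_itv /= lexx ler01.
  by rewrite /seg scale0r addr0.
move=> w _; apply: connected_continuous_connected; first exact: segment_connected.
apply: continuous_subspaceT => t; apply: cvgD; first exact: cvg_cst.
by apply: cvgZ; [exact: cont_real_complex|exact: cvg_cst].
Qed.

Lemma unit_cont_kernel (l : C) (r : R) : nr l < r ->
  unit_cont (fun t => (fun z => z / (z - l)) (r%:C * circle_pt t) : C).
Proof.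
move=> lr; have r0 : 0 <= r by exact: le_trans (nr_ge0 l) (ltW lr).
apply: (@unit_cont_circle R (fun z => z / (z - l))) => // z zr.
apply/differentiable_continuous/differentiableM; first exact: ex_diff.
by apply: differentiable_kernel; apply: nr_subl_gt0; rewrite zr.
Qed.

(** By continuity up to the boundary, [S] varies by less than [r] near each point of the unit
    circle, and compactness makes the width of these neighbourhoods uniform. With [x0] the modulus
    of [t0], the circle obtained encloses [t0]. *)
Lemma disc_circle_near (V : normedModType R[i]) (S : C -> V) (A : set V) (r x0 : R) :
  {within [set z : C | nr z <= 1], continuous S} -> 0 < r -> x0 < 1 ->
  (forall z, nr z = 1 -> exists2 b, A b & nr (S z - b) < r) ->
  exists rho, [/\ x0 < rho, 0 < rho < 1 & forall t, 0 <= t <= 1 ->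
    exists2 b, A b & nr (S (rho%:C * circle_pt t) - b) < 2 * r].
Proof.
move=> cS r0 x01 SA.
(* [S] is continuous only within the closed disc, hence the premise that the point lies in it. *)
have [|x xgt0 Hx] := @unit_uniform R (fun x t =>
    nr ((1 - x)%:C * circle_pt t : C) <= 1 ->
    exists2 b, A b & nr (S ((1 - x)%:C * circle_pt t) - b) < 2 * r).
  move=> t _; have ct : nr (circle_pt t : C) = 1 := nr_circle_pt t.
  have uc : nr (circle_pt t : C) <= 1 by rewrite ct.
  have [b Ab Sb] := SA _ ct.
  have /subspace_continuousP/(_ _ uc)/cvg_nrP/(_ r r0) := cS.
  rewrite near_withinE => /nbhs_nrP[e e0 He].
  exists (e / 2); first by rewrite divr_gt0.
  have /cvg_nrP/(_ (e / 2)) := @cont_circle R 1 t.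
  rewrite divr_gt0// => /(_ isT); apply: filterS => s.
  rewrite !mul1r => sc x /andP[x1 xe] x2; exists b => //.
  apply: le_lt_trans (ler_nrBD _ (S (circle_pt t)) _) _.
  suff : nr (S ((1 - x)%:C * circle_pt s) - S (circle_pt t)) < r by lra.
  apply: He => //.
  rewrite (_ : _ - _ = (circle_pt s - circle_pt t) - x%:C * circle_pt s); last first.
    by rewrite rmorphB /=; ring.
  apply: le_lt_trans (ler_nrB _ _) _.
  by rewrite nrM nr_real nr_circle_pt gtr0_norm//; lra.
(* The three bounds put [y] in the range of [Hx], keep [1 - y] above [x0], and keep it positive. *)
pose y := Num.min (Num.min (x / 2) ((1 - x0) / 2)) (1 / 2).
have y0 : 0 < y by rewrite !lt_min !divr_gt0 ?subr_gt0.
have y1 : y <= x / 2 by rewrite /y !ge_min lexx.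
have y2 : y <= (1 - x0) / 2 by rewrite /y !ge_min lexx orbT.
have y3 : y <= 1 / 2 by rewrite /y ge_min lexx orbT.
clearbody y; exists (1 - y); split; [lra|by apply/andP; split; lra|move=> t t01].
apply: (Hx y) => //; first by apply/andP; split; lra.
by rewrite nr_circle; lra.
Qed.

(** A Lebesgue number for the compact disc: translations shorter than [e] keep the whole disc in
    [U], as needed to apply Cauchy's formula along the translated disc. *)
Lemma disc_uniform_nbhs (V : normedModType R[i]) (S : C -> V) (U : set V) (rho : R) :
  open U -> (forall z, nr z <= rho -> U (S z)) ->
  (forall z, nr z <= rho -> {for z, continuous S}) ->
  exists2 e : R, 0 < e & forall z h, nr z <= rho -> nr h < e -> U (S z + h).
Proof.
move=> oU US cS.
have [|e e0 He] := @compact_uniform R _ [set z : C | nr z <= rho]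
    (fun e z => nr z <= rho -> forall h, nr h < e -> U (S z + h)) (@compact_disc rho).
  move=> z /= zr; have [e e0 He] := open_nr oU (US z zr).
  have e2 : 0 < e / 2 by rewrite divr_gt0.
  have /cont_nrP/(_ _ e2)[e' e'0 He'] := cS z zr.
  exists (e / 2) => //.
  apply/nbhs_nrP; exists e' => // y yz x /andP[x0 xe] _ h hx; apply: He.
  by rewrite addrAC; apply: le_lt_trans (ler_nrD _ _) _; have := He' y yz; lra.
exists (e / 2); first by rewrite divr_gt0.
by move=> z h zr; apply: (He (e / 2)) => //; apply/andP; split; lra.
Qed.

(* The extension is [v |-> (1 / 2 i pi) \oint f (v + S z - S t0) / (z - t0) dz]
   over the circle of radius rho, which is f v as long as the translated disc
   stays in U. *)
Lemma extension_along_disc (V : normedModType R[i]) (f : V -> C) (U : set V)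
    (S : C -> V) (t0 : C) (rho r : R) :
  open U -> (forall v, U v -> differentiable f v) ->
  (forall z, nr z < 1 -> U (S z) /\ differentiable S z) ->
  nr t0 < rho -> rho < 1 -> 0 < r ->
  (forall t h, 0 <= t <= 1 -> nr h < r -> U (S (rho%:C * circle_pt t) + h)) ->
  exists g : V -> C, (forall v, nr (v - S t0) < r -> differentiable g v) /\
    exists2 e : R, 0 < e <= r & forall v, nr (v - S t0) < e -> U v /\ f v = g v.
Proof.
move=> oU df HS t0rho rho1 r0 Ur.
have t00 := nr_ge0 t0; have rho0 : 0 <= rho by lra.
have nrho t : nr (rho%:C * circle_pt t : C) = rho by exact: nr_circle.
pose s t := S (rho%:C * circle_pt t) - S t0.
pose ker (z : C) : C := z / (z - t0).
have cker : unit_cont (fun t => ker (rho%:C * circle_pt t)) := unit_cont_kernel t0rho.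
exists (fun v => mean (fun t => f (v + s t) * ker (rho%:C * circle_pt t))); split.
  move=> v vr; apply: (differentiable_mean oU df) cker => t t01; split.
    by rewrite /s addrCA; exact: Ur.
  have zr : nr (rho%:C * circle_pt t : C) < 1 by rewrite nrho.
  have cS := differentiable_continuous (HS _ zr).2.
  apply: cvgB; last exact: cvg_cst.
  exact: (continuous_comp (@cont_circle R rho t) cS).
(* Cauchy's formula asks for holomorphy on a disc strictly larger than the circle, while
   [disc_uniform_nbhs] asks for a closed disc inside the open unit disc; a radius between [rho] and
   1 meets both demands. *)
pose rho' := (rho + 1) / 2.
have zrho' (z : C) : nr z <= rho' -> nr z < 1 by rewrite /rho'; lra.
have [| |e e0 He] := @disc_uniform_nbhs V S U rho' oU.
- by move=> z /zrho' /HS[].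
- by move=> z /zrho' /HS[_]; exact: differentiable_continuous.
exists (Num.min e r); first by rewrite lt_min e0 r0 ge_min lexx orbT.
move=> v; rewrite lt_min => /andP[ve vr]; split.
  by rewrite -[v](subrKC (S t0)); apply: He => //; rewrite /rho'; lra.
pose u (z : C) := f (v + (S z - S t0)).
have du z : nr z < rho' -> differentiable u z.
  move=> zr.
  apply: (@differentiable_comp _ _ _ _ (fun z => v + (S z - S t0)) f).
    apply: differentiableD; first exact: differentiable_cst.
    apply: differentiableB; last exact: differentiable_cst.
    by have [] := HS _ (zrho' _ (ltW zr)).
  by apply: df; rewrite addrCA; apply: He => //; exact: ltW.
have -> : f v = u t0 by rewrite /u subrr addr0.
rewrite -(@cauchy_formula R u rho' t0 rho du)//.
by rewrite t0rho /rho'; lra.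
Qed.

End MeanOfTranslates.

(** * The continuity principle *)

Lemma enlargementP (R : realType) (n : nat) (A : set 'rV[R[i]^o]_n) (e : R) w :
  enlargement A e w <-> exists2 v, A v & nr (w - v) < e.
Proof.
by split=> [[v Av]|[v Av wv]]; [|exists v => //]; rewrite -ball_normE /ball_ /=;
  rewrite nr_ltE nrBC => // ?; exists v.
Qed.

Theorem theorem4p3 (R : realType) (n : nat) (U : set 'rV[R[i]^o]_n) :
  domain_of_holomorphy U -> continuity_principle U.
Proof.
move=> [[oU _] [f [hf nex]]] S B T hS SU cB BU cT SB ST w Tw.
apply: contrapT => Uw; apply: (nex w Uw).
have [|d d0 Hd] := @compact_uniform R _ B
    (fun d b => forall h, nr h < d -> U (b + h)) cB.
  move=> b /BU /(open_nr oU)[d d0 Hd]; exists (d / 2); first by rewrite divr_gt0.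
  apply/nbhs_nrP; exists (d / 2); first by rewrite divr_gt0.
  move=> b' bb' x /andP[x0 xd] h hx; apply: Hd.
  by rewrite addrAC; apply: le_lt_trans (ler_nrD _ _) _; lra.
(* Any fraction with [3 * r < d] would do. *)
pose r := d / 4; have r0 : 0 < r by rewrite divr_gt0.
have Ur b h : B b -> nr h < 3 * r -> U (b + h).
  by move=> Bb hr; apply: (Hd (3 * r)) => //; rewrite /r; apply/andP; split; lra.
have [j1 Hj1] := SB r r0; have [j2 Hj2] := ST r r0.
pose j := maxn j1 j2.
have [SjB _] := Hj1 j (leq_maxl _ _); have [_ TSj] := Hj2 j (leq_maxr _ _).
(* The parameter [t0] is chosen so that [w] lies in the ball of radius [r] around [S t0], on which
   the extension will live. *)
move/enlargementP: (TSj w Tw) => [_ [t0 t01 <-] wp].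
move: SjB wp (hS j) (SU j) => {Hj1 Hj2 TSj hS SU SB ST}.
move: (S j) => {j}S SB wp [cS dS] SU.
have closed_discE : closed_unit_disc = [set z : R[i]^o | nr z <= 1].
  by apply/seteqP; split => z; rewrite /closed_unit_disc /= nrE lecR.
rewrite closed_discE in cS; rewrite /unit_disc /= nr_ltE in t01.
have [z z1|rho [t0rho /andP[rho0 rho1] Hrho]] := disc_circle_near cS r0 t01 (A := B).
  apply/enlargementP; apply: SB; exists z => //.
  by rewrite /unit_circle /= nrE z1.
have [z z1|t h t01' hr|g [dg [e /andP[e0 er] fg]]] :=
    @extension_along_disc R _ f U S t0 rho r oU hf _ t0rho rho1 r0.
- have uz : unit_disc z by rewrite /unit_disc /= nr_ltE.
  by split; [apply: SU; left; exists z|exact: dS].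
- have [b Bb Sb] := Hrho t t01'.
  rewrite -[S _](subrKC b) -addrA; apply: Ur => //.
  by apply: le_lt_trans (ler_nrD _ _) _; lra.
exists [set v | nr (v - S t0) < r], g; split => //.
- exact: open_nr_ball.
- exact: connected_nr_ball.
(* Agreement is known only on this smaller ball, which contains [S t0]; the larger ball leaves [U]
   at [w]. *)
exists [set v | nr (v - S t0) < e]; split.
- exact: open_nr_ball.
- by exists (S t0); rewrite /= subrr nr0.
- by move=> v /= ve; split; [exact: (fg v ve).1|exact: lt_le_trans er].
- by move=> v /= /fg[].
Qed.
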